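(* With the notation of the context, the following hold. (1) $(\mathcal H_{\mathrm{vinc}},\blacksquare,\Delta_{\heartsuit},u',\varepsilon')$ is a bialgebra. (2) $(\mathcal H_{\mathrm{vinc}},\heartsuit,\Delta_{\blacksquare},u',\varepsilon')$ is a connected filtered Hopf algebra, with respect to the filtration coming from the grading $\mathcal H_{\mathrm{vinc}}=\bigoplus_{n\in\mathbb N}\mathbb Q[\mathbf{StIP}_n\times\mathbf S_n]$.
   Context: $\mathbb N=\{0,1,2,\dots\}$, $\mathbb N_{\ge1}=\{1,2,\dots\}$, $[n]=\{1,\dots,n\}$, $[0]=\emptyset$. For a finite set $A\subset\mathbb N_{\ge1}$, an interval partition of $A$ is a finite set $\mathcal I$ of non-empty pairwise disjoint sets (blocks) with union $A$, each block being an interval of $\mathbb N_{\ge1}$ (a set of consecutive integers $\{a,a+1,\dots,b\}$). $\mathbf{IP}(A)$ is the set of these ($\mathbf{IP}(\emptyset)=\{\emptyset\}$), $\mathbf{IP}=\bigcup_A\mathbf{IP}(A)$, and $\bigcup\mathcal I$ denotes the ground set of $\mathcal I$. $\mathbf{StIP}_n:=\mathbf{IP}([n])$, $\mathbf{StIP}:=\bigcup_n\mathbf{StIP}_n$. $\mathbf S_n$ is the symmetric group on $[n]$ ($\mathbf S_0$ contains only the empty permutation), permutations being written in one-line notation $\sigma=\sigma_1\cdots\sigma_n$; $\mathbf S=\bigcup_n\mathbf S_n$. Standardization of partitions: for $\mathcal I\in\mathbf{IP}$ with $|\bigcup\mathcal I|=n$, $\mathbf{std}(\mathcal I)\in\mathbf{StIP}_n$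 is the image of $\mathcal I$, block by block, under the unique order-preserving bijection $\bigcup\mathcal I\to[n]$. Standardization of permutations: for $\sigma\in\mathbf S_n$ and $A=\{a_1<\dots<a_k\}\subset[n]$ (positions), $\mathbf{st}(\sigma|_A)\in\mathbf S_k$ is the permutation with the same relative order as $\sigma_{a_1}\cdots\sigma_{a_k}$. Gluing: for $\mathcal I,\mathcal J\in\mathbf{IP}$, let $\sim$ be the smallest equivalence relation on the set of blocks $\mathcal I\cup\mathcal J$ such that $E\sim F$ whenever $E\cap F\neq\emptyset$. Then $\mathcal I\cdot_{\mathrm{glue}}\mathcal J:=\{\bigcup_{X\in[T]_\sim}X\mid T\in\mathcal I\cup\mathcal J\}$, an interval partition of $\bigcup\mathcal I\cup\bigcup\mathcal J$. $\mathcal H_{\mathrm{vinc}}$ is the free $\mathbb Q$-vector space on $\bigcup_n\mathbf{StIP}_n\times\mathbf S_n$. Operations, given on basis elements and extended linearly: - $(\mathfrak s,\sigma)\blacksquare(\mathfrak t,\tau):=(\mathfrak s\bullet\mathfrak t,\sigma\,\square\,\tau)$, where $\mathfrak s\bullet\mathfrak t$ consists of the blocks of $\mathfrak s$ together with the blocks of $\mathfrak t$ translated by $|\bigcup\mathfrak s|$, and $\sigma\,\square\,\tau:=\sigma_1\cdots\sigma_m(\tau_1+m)\cdots(\tau_n+m)$ for $\sigma\in\mathbf S_m,\tau\in\mathbf S_n$; - $\Delta_\blacksquare((\mathfrak s,\sigma)):=\sum(\mathfrak a,\alpha)\otimes(\mathfrak b,\beta)$, the sum over all basis elements $(\mathfrak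 a,\alpha),(\mathfrak b,\beta)$ with $\mathfrak a\bullet\mathfrak b=\mathfrak s$ and $\alpha\,\square\,\beta=\sigma$ (the dual of $\blacksquare$); - $\Delta_\heartsuit((\mathfrak s,\sigma)):=\sum_{A\cup A'=\bigcup\mathfrak s}\ \sum_{\mathcal I\in\mathbf{IP}(A),\,\mathcal I'\in\mathbf{IP}(A'),\ \mathcal I\cdot_{\mathrm{glue}}\mathcal I'=\mathfrak s}(\mathbf{std}(\mathcal I),\mathbf{st}(\sigma|_A))\otimes(\mathbf{std}(\mathcal I'),\mathbf{st}(\sigma|_{A'}))$, the outer sum over ordered pairs of (not necessarily disjoint) subsets; - $(\mathfrak s,\sigma)\heartsuit(\mathfrak t,\tau):=\sum_{(\mathfrak g,\gamma)}\langle(\mathfrak s,\sigma)\otimes(\mathfrak t,\tau),\Delta_\heartsuit((\mathfrak g,\gamma))\rangle\,(\mathfrak g,\gamma)$, the dual of $\Delta_\heartsuit$ for the pairing making basis elements orthonormal (a finite sum); - unit $u'(1)=e:=(\emptyset,\text{empty permutation})$; counit $\varepsilon'(e)=1$ and $\varepsilon'=0$ on all other basis elements. The filtration coming from a grading $\bigoplus_n V_n$ is $F_n=\bigoplus_{k\le n}V_k$. A bialgebra is filtered by $(F_n)$ if $F_p\cdot F_q\subset F_{p+q}$ and $\Delta(F_n)\subset\sum_{p+q=n}F_p\otimes F_q$, and connected if $F_0$ is one-dimensional. *)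

(* Defs.v *)
From mathcomp Require Import all_boot all_order all_algebra all_fingroup.
From mathcomp Require Import finmap monalg.

Set Implicit Arguments.
Unset Strict Implicit.
Unset Printing Implicit Defensive.

Import GRing.Theory.
Local Open Scope ring_scope.

(* Free rational vector spaces and their tensor products. The tensor product
   of the free spaces on K and L is the free space on K * L, with
   tens <<k>> <<l>> = <<(k, l)>>. *)

Notation freeQ K := {malg rat[K]}.

Definition lin_ext (K : choiceType) (V : lmodType rat) (f : K -> V)
    (x : freeQ K) : V :=
  \sum_(k <- msupp x) x@_k *: f k.

Definition tens (K L : choiceType) (x : freeQ K) (y : freeQ L) :
    freeQ (K * L)%type :=
  lin_ext (fun k => lin_ext (fun l => << (k, l) >>) y) x.

(* The linear map on the tensor product induced by a bilinear map b;
   see tlift_tens. *)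
Definition tlift (K L : choiceType) (V : lmodType rat)
    (b : freeQ K -> freeQ L -> V) (w : freeQ (K * L)%type) : V :=
  lin_ext (fun kl => b << kl.1 >> << kl.2 >>) w.

Definition bilinear_map (U V W : lmodType rat) (b : U -> V -> W) : Prop :=
  (forall u, linear (b u)) /\ (forall v, linear (b^~ v)).

Definition tens_mul (K : choiceType) (mul : freeQ K -> freeQ K -> freeQ K)
    (w z : freeQ (K * K)%type) : freeQ (K * K)%type :=
  tlift (fun a b => tlift (fun c d => tens (mul a c) (mul b d)) z) w.

Definition pairing (K : choiceType) (x y : freeQ K) : rat :=
  \sum_(k <- msupp x) x@_k * y@_k.

Lemma lin_extE (K : choiceType) (V : lmodType rat) (f : K -> V) x
    (d : {fset K}) :
  (msupp x `<=` d)%fset -> lin_ext f x = \sum_(k <- d) x@_k *: f k.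
Proof.
move=> le; rewrite /lin_ext; apply/big_fset_incl => // k _ kx.
by rewrite mcoeff_outdom // scale0r.
Qed.

Lemma lin_ext_linear (K : choiceType) (V : lmodType rat) (f : K -> V) :
  linear (lin_ext f).
Proof.
move=> a x y; pose d := (msupp x `|` msupp y)%fset.
have hx : (msupp x `<=` d)%fset by apply: fsubsetUl.
have hy : (msupp y `<=` d)%fset by apply: fsubsetUr.
have hs : (msupp (a *: x + y) `<=` d)%fset.
  apply: fsubset_trans (msuppD_le _ _) _.
  by apply: fsetSU; apply: msuppZ_le.
rewrite !(lin_extE _ hs, lin_extE _ hx, lin_extE _ hy).
rewrite scaler_sumr -big_split /=; apply: eq_bigr => k _.
by rewrite mcoeffD mcoeffZ scalerDl scalerA.
Qed.

Lemma lin_extU (K : choiceType) (V : lmodType rat) (f : K -> V) k :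
  lin_ext f << k >> = f k.
Proof. by rewrite /lin_ext msuppU oner_eq0 big_seq_fset1 mcoeffUU scale1r. Qed.

Lemma tens_basis (K L : choiceType) (k : K) (l : L) :
  tens << k >> << l >> = << (k, l) >>.
Proof. by rewrite /tens !lin_extU. Qed.

Lemma linear_lin_ext (K : choiceType) (U V : lmodType rat) (f : K -> U)
    (g : U -> V) x :
  linear g -> g (lin_ext f x) = lin_ext (g \o f) x.
Proof.
move=> lg.
have g0 : g 0 = 0 by have := lg (-1) 0 0; rewrite !scaleN1r !addNr.
rewrite /lin_ext; elim/big_rec2: _ => // k u v _ <-.
by rewrite lg.
Qed.

Lemma eq_lin_ext (K : choiceType) (V : lmodType rat) (f g : K -> V) x :
  f =1 g -> lin_ext f x = lin_ext g x.
Proof. by move=> fg; apply: eq_bigr => k _; rewrite fg. Qed.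

Lemma lin_ext_id (K : choiceType) (x : freeQ K) :
  lin_ext (fun k => << k >>) x = x.
Proof.
apply/malgP => k; rewrite [in RHS](monalgE x) !raddf_sum /=.
by apply: eq_bigr => i _; rewrite mcoeffZ !mcoeffU mulr_natr.
Qed.

Lemma tlift_tens (K L : choiceType) (V : lmodType rat)
    (b : freeQ K -> freeQ L -> V) x y :
  bilinear_map b -> tlift b (tens x y) = b x y.
Proof.
move=> [b1 b2]; rewrite /tlift /tens (linear_lin_ext _ _ (lin_ext_linear _)).
rewrite -[in RHS](lin_ext_id x) (linear_lin_ext _ _ (b2 y)).
apply: eq_lin_ext => k /=; rewrite (linear_lin_ext _ _ (lin_ext_linear _)).
rewrite -[in RHS](lin_ext_id y) (linear_lin_ext _ _ (b1 _)).
by apply: eq_lin_ext => l /=; rewrite lin_extU.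
Qed.

(* Bialgebras and Hopf algebras carried by a free vector space *)

Section Bialgebra.
Variables (K : choiceType).
Local Notation H := (freeQ K).
Local Notation HH := (freeQ (K * K)%type).
Variables (mul : H -> H -> H) (comul : H -> HH) (eta : rat -> H)
          (eps : H -> rat).

Definition is_algebra : Prop :=
  [/\ bilinear_map mul, linear (eta : rat^o -> H), associative mul,
      left_id (eta 1) mul & right_id (eta 1) mul].

(* Both sides of coassociativity live in the free space on K * K * K, with
   a (x) (b (x) c) identified with (a (x) b) (x) c. *)
Definition is_coalgebra : Prop :=
  [/\ linear comul, scalar eps,
      forall x, tlift (fun a b => tens (comul a) b) (comul x) =
        tlift (fun a w => tlift (fun b c => tens (tens a b) c) w)
          (tlift (fun a b => tens a (comul b)) (comul x)),
      forall x, tlift (fun a b => eps a *: b) (comul x) = x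
    & forall x, tlift (fun a b => eps b *: a) (comul x) = x].

Definition is_bialgebra : Prop :=
  [/\ is_algebra /\ is_coalgebra,
      forall x y, comul (mul x y) = tens_mul mul (comul x) (comul y),
      comul (eta 1) = tens (eta 1) (eta 1),
      forall x y, eps (mul x y) = eps x * eps y
    & eps (eta 1) = 1].

Definition is_antipode (S : H -> H) : Prop :=
  [/\ linear S,
      forall x, tlift (fun a b => mul (S a) b) (comul x) = eta (eps x)
    & forall x, tlift (fun a b => mul a (S b)) (comul x) = eta (eps x)].

Definition is_hopf_algebra : Prop :=
  is_bialgebra /\ exists S, is_antipode S.

(* w lies in the sum over p + q = n of F p (x) F q *)
Definition tensor_filtration (F : nat -> H -> Prop) (n : nat) (w : HH) : Prop :=
  exists2 s : seq (H * H), w = \sum_(u <- s) tens u.1 u.2 &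
    forall u, u \in s -> exists p q : nat,
      [/\ (p + q)%N = n, F p u.1 & F q u.2].

Definition is_filtered (F : nat -> H -> Prop) : Prop :=
  (forall p q x y, F p x -> F q y -> F (p + q)%N (mul x y)) /\
  (forall n x, F n x -> tensor_filtration F n (comul x)).

End Bialgebra.

Definition one_dimensional (V : lmodType rat) (F : V -> Prop) : Prop :=
  exists2 v, F v /\ v != 0 & forall x, F x <-> exists c, x = c *: v.

Definition is_connected (V : lmodType rat) (F : nat -> V -> Prop) : Prop :=
  one_dimensional (F 0%N).

Definition filtration_of_grading (V : lmodType rat) (G : nat -> V -> Prop)
    (n : nat) (x : V) : Prop :=
  exists2 y : 'I_n.+1 -> V, (forall k : 'I_n.+1, G k (y k)) & x = \sum_k y k.

(* Interval partitions. The set [n] = {1, ..., n} is 'I_n = {0, ..., n - 1}. *)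

Definition is_interval (n : nat) (B : {set 'I_n}) : bool :=
  [exists a : 'I_n, exists b : 'I_n, B == [set i : 'I_n | (a <= i <= b)%N]].

Definition is_ip (n : nat) (A : {set 'I_n}) (P : {set {set 'I_n}}) : bool :=
  partition P A && [forall B in P, is_interval B].

Definition IP (n : nat) (A : {set 'I_n}) :=
  {P : {set {set 'I_n}} | is_ip A P}.

Definition StIP (n : nat) := IP [set: 'I_n].


(* enum_val : 'I_#|A| -> 'I_n is the increasing bijection onto A. *)
Lemma ltn_enum_val n (A : {set 'I_n}) (i j : 'I_#|A|) :
  (enum_val i < enum_val j)%N = (i < j)%N.
Proof.
have mono (k l : 'I_#|A|) : (k < l)%N -> (enum_val k < enum_val l)%N.
  move=> kl; have x0 : 'I_n by apply: (enum_val k).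
  have srt : sorted ltn (map val (enum A)).
    apply: (subseq_sorted ltn_trans (s2 := map val (enum 'I_n))).
      by apply: map_subseq; rewrite [enum 'I_n]enumT; apply: filter_subseq.
    by rewrite val_enum_ord iota_ltn_sorted.
  rewrite !(enum_val_nth x0).
  rewrite -!(nth_map x0 0%N val); try by rewrite -cardE.
  by apply: (sorted_ltn_nth ltn_trans) => //; rewrite inE size_map -cardE.
case: (ltngtP i j) => [/mono //|/mono h|/val_inj ->]; last by rewrite ltnn.
by rewrite ltnNge (ltnW h).
Qed.

Lemma leq_enum_val n (A : {set 'I_n}) (i j : 'I_#|A|) :
  (enum_val i <= enum_val j)%N = (i <= j)%N.
Proof. by rewrite leqNgt ltn_enum_val -leqNgt. Qed.

Definition std_set (n : nat) (A : {set 'I_n}) (I : {set {set 'I_n}}) :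
    {set {set 'I_#|A|}} :=
  [set [set i : 'I_#|A| | enum_val i \in (B : {set 'I_n})] | B in I].

Lemma std_subproof n (A : {set 'I_n}) (I : IP A) :
  is_ip [set: 'I_#|A|] (std_set A (val I)).
Proof.
case: I => I /= /andP[/and3P[/eqP cov /trivIsetP triv I0] /forall_inP int].
have sub B : B \in I -> B \subset A.
  by move=> BI; rewrite -cov; apply: bigcup_sup.
apply/andP; split.
  apply/and3P; split.
  - rewrite eqEsubset subsetT /=; apply/subsetP => i _.
    have : enum_val i \in cover I by rewrite cov enum_valP.
    case/bigcupP => B BI iB; apply/bigcupP.
    by exists [set j : 'I_#|A| | enum_val j \in B]; [apply: imset_f|rewrite inE].
  - apply/trivIsetP => X Y /imsetP[B BI ->] /imsetP[C CI ->] XY.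
    have BC : B != C by apply: contraNneq XY => ->.
    have /pred0P dBC := triv B C BI CI BC.
    by apply/pred0P => i /=; rewrite !inE; have /= := dBC (enum_val i).
  - apply/imsetP => -[B BI h].
    have [B0|[x xB]] := set_0Vmem B; first by rewrite -B0 BI in I0.
    have xA := subsetP (sub B BI) x xB.
    have : enum_rank_in xA x \in (set0 : {set 'I_#|A|}).
      by rewrite h inE enum_rankK_in.
    by rewrite inE.
apply/forall_inP => X /imsetP[B BI ->].
have [B0|[x xB]] := set_0Vmem B; first by rewrite -B0 BI in I0.
have /existsP[a /existsP[b /eqP eB]] := int B BI.
have ab : (a <= b)%N by move: xB; rewrite eB inE => /andP[]; apply: leq_trans.
have aA : a \in A by apply: (subsetP (sub B BI)); rewrite eB inE leqnn.
have bA : b \in A by apply: (subsetP (sub B BI)); rewrite eB inE leqnn andbT.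
apply/existsP; exists (enum_rank_in aA a).
apply/existsP; exists (enum_rank_in bA b).
apply/eqP/setP => i; rewrite !inE eB inE -!leq_enum_val.
by rewrite !enum_rankK_in.
Qed.

Definition std (n : nat) (A : {set 'I_n}) (I : IP A) : StIP #|A| :=
  Sub (std_set A (val I)) (std_subproof I).

Definition glue (n : nat) (I J : {set {set 'I_n}}) : {set {set 'I_n}} :=
  let meets := fun E F : {set 'I_n} =>
    [&& E \in I :|: J, F \in I :|: J & E :&: F != set0] in
  [set \bigcup_(X in I :|: J | connect meets T X) X | T in I :|: J].

Definition ip_cat_set (m n : nat) (s : {set {set 'I_m}})
    (t : {set {set 'I_n}}) : {set {set 'I_(m + n)}} :=
  [set [set lshift n i | i in (B : {set 'I_m})] | B in s] :|:
  [set [set rshift m i | i in (B : {set 'I_n})] | B in t].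

Lemma ip_cat_subproof m n (s : StIP m) (t : StIP n) :
  is_ip [set: 'I_(m + n)] (ip_cat_set (val s) (val t)).
Proof.
case: s t => [s /= /andP[/and3P[/eqP covs /trivIsetP trs s0] /forall_inP ints]].
case=> [t /= /andP[/and3P[/eqP covt /trivIsetP trt t0] /forall_inP intt]].
have lr i j : (lshift n i == rshift m j) = false by apply: eq_lrshift.
apply/andP; split.
  apply/and3P; split.
  - rewrite eqEsubset subsetT /=; apply/subsetP => i _; apply/bigcupP.
    rewrite -(splitK i); case: (split i) => j /=.
      have : j \in cover s by rewrite covs inE.
      case/bigcupP => B Bs jB; exists [set lshift n i | i in B].
        by apply/setUP; left; apply: imset_f.
      exact: imset_f.
    have : j \in cover t by rewrite covt inE.
    case/bigcupP => B Bt jB; exists [set rshift m i | i in B].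
      by apply/setUP; right; apply: imset_f.
    exact: imset_f.
  - apply/trivIsetP => X Y; rewrite !inE.
    case/orP=> /imsetP[B Bs ->] /orP[]/imsetP[C Cs ->] XY.
    + rewrite imset_disjoint; last exact: lshift_inj.
      by apply: trs => //; apply: contraNneq XY => ->.
    + apply/pred0P => i /=; apply/negP => /andP[/imsetP[a _ ->]].
      by case/imsetP=> b _ /eqP; rewrite lr.
    + apply/pred0P => i /=; apply/negP => /andP[/imsetP[a _ ->]].
      by case/imsetP=> b _ /eqP; rewrite eq_sym lr.
    + rewrite imset_disjoint; last exact: rshift_inj.
      by apply: trt => //; apply: contraNneq XY => ->.
  - apply/negP; rewrite inE => /orP[]/imsetP[B BI h].
      by move/esym/eqP: h; rewrite imset_eq0 => /eqP h; rewrite -h BI in s0.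
    by move/esym/eqP: h; rewrite imset_eq0 => /eqP h; rewrite -h BI in t0.
apply/forall_inP => X; rewrite inE => /orP[]/imsetP[B BI ->].
  have /existsP[a /existsP[b /eqP eB]] := ints B BI.
  apply/existsP; exists (lshift n a); apply/existsP; exists (lshift n b).
  apply/eqP/setP => i; rewrite -(splitK i); case: (split i) => j /=.
    by rewrite mem_imset; [rewrite eB !inE | apply: lshift_inj].
  rewrite inE /=; apply/imsetP/andP => [[k _ /eqP]|[_ h]].
    by rewrite eq_sym lr.
  by have := leq_ltn_trans h (ltn_ord b); rewrite ltnNge leq_addr.
have /existsP[a /existsP[b /eqP eB]] := intt B BI.
apply/existsP; exists (rshift m a); apply/existsP; exists (rshift m b).
apply/eqP/setP => i; rewrite -(splitK i); case: (split i) => j /=.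
  rewrite inE /=; apply/imsetP/andP => [[k _ /eqP]|[h _]].
    by rewrite lr.
  by have := leq_ltn_trans h (ltn_ord j); rewrite ltnNge leq_addr.
by rewrite mem_imset; [rewrite eB !inE /= !leq_add2l | apply: rshift_inj].
Qed.

Definition ip_cat (m n : nat) (s : StIP m) (t : StIP n) : StIP (m + n) :=
  Sub (ip_cat_set (val s) (val t)) (ip_cat_subproof s t).

(* Permutations: sigma i is the letter in position i of the one-line
   notation of sigma : 'S_n. *)

Definition perm_cat_fun (m n : nat) (s : 'S_m) (t : 'S_n) (i : 'I_(m + n)) :
    'I_(m + n) :=
  match split i with
  | inl j => lshift n (s j)
  | inr k => rshift m (t k)
  end.

Lemma perm_cat_inj m n (s : 'S_m) (t : 'S_n) : injective (perm_cat_fun s t).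
Proof.
move=> i j; rewrite -{2}(splitK i) -{2}(splitK j) /perm_cat_fun.
case: (split i) (split j) => a [] b /=.
- by move/lshift_inj/perm_inj => ->.
- by move/eqP; rewrite eq_lrshift.
- by move/eqP; rewrite eq_rlshift.
- by move/rshift_inj/perm_inj => ->.
Qed.

Definition perm_cat (m n : nat) (s : 'S_m) (t : 'S_n) : 'S_(m + n) :=
  perm (@perm_cat_inj m n s t).

Lemma st_bound n (s : 'S_n) (A : {set 'I_n}) (i : 'I_#|A|) :
  (#|[set j : 'I_#|A| | s (enum_val j) < s (enum_val i)]| < #|A|)%N.
Proof.
rewrite -[X in (_ < X)%N]card_ord -cardsT; apply: proper_card.
by rewrite properT; apply/negP => /eqP/setP/(_ i); rewrite !inE ltnn.
Qed.

Definition st_fun (n : nat) (s : 'S_n) (A : {set 'I_n}) (i : 'I_#|A|) :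
    'I_#|A| :=
  Ordinal (st_bound s i).

Lemma st_fun_lt n (s : 'S_n) (A : {set 'I_n}) (i j : 'I_#|A|) :
  (s (enum_val i) < s (enum_val j))%N -> (st_fun s i < st_fun s j)%N.
Proof.
move=> ij; apply: proper_card; apply/properP; split.
  by apply/subsetP => k; rewrite !inE => /ltn_trans; apply.
by exists i; rewrite inE ?ltnn.
Qed.

Lemma st_fun_inj n (s : 'S_n) (A : {set 'I_n}) : injective (@st_fun n s A).
Proof.
move=> i j eij; case: (ltngtP (s (enum_val i)) (s (enum_val j))).
- by move/st_fun_lt; rewrite eij ltnn.
- by move/st_fun_lt; rewrite eij ltnn.
- by move/val_inj/perm_inj/enum_val_inj.
Qed.

Definition st (n : nat) (s : 'S_n) (A : {set 'I_n}) : 'S_#|A| :=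
  perm (@st_fun_inj n s A).

Lemma st_lt n (s : 'S_n) (A : {set 'I_n}) (i j : 'I_#|A|) :
  (st s A i < st s A j)%N = (s (enum_val i) < s (enum_val j))%N.
Proof.
rewrite !permE; case: (ltngtP (s (enum_val i)) (s (enum_val j))).
- exact: st_fun_lt.
- by move/st_fun_lt/ltnW; rewrite leqNgt => /negbTE.
- by move/val_inj/perm_inj/enum_val_inj => ->; rewrite ltnn.
Qed.

(* The space H_vinc *)

Definition vinc := {n : nat & (StIP n * 'S_n)%type}.

Definition mk_vinc (n : nat) (s : StIP n) (sigma : 'S_n) : vinc :=
  Tagged (fun n => (StIP n * 'S_n)%type) (s, sigma).

Notation Hvinc := (freeQ vinc).

Definition deg (x : vinc) : nat := tag x.

Definition vinc_cat (x y : vinc) : vinc :=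
  mk_vinc (ip_cat (tagged x).1 (tagged y).1)
          (perm_cat (tagged x).2 (tagged y).2).

Lemma empty_subproof : is_ip [set: 'I_0] (set0 : {set {set 'I_0}}).
Proof.
apply/andP; split; last by apply/forall_inP => B; rewrite inE.
apply/and3P; split; last by rewrite inE.
  by rewrite /cover big_set0; apply/eqP/setP => -[].
by apply/trivIsetP => A B; rewrite inE.
Qed.

Definition vinc_e : vinc :=
  mk_vinc (Sub (set0 : {set {set 'I_0}}) empty_subproof : StIP 0) 1%g.

Definition upto (n : nat) : seq vinc :=
  [seq mk_vinc a.1 a.2 | k <- iota 0 n.+1, a <- enum {: StIP k * 'S_k}].

Definition black (x y : Hvinc) : Hvinc :=
  lin_ext (fun a => lin_ext (fun b => << vinc_cat a b >>) y) x.

(* The restriction to degrees at most deg g loses no term; see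
   pairing_comul_black. *)
Definition comul_black (x : Hvinc) : freeQ (vinc * vinc)%type :=
  lin_ext (fun g =>
    \sum_(a <- upto (deg g)) \sum_(b <- upto (deg g) | vinc_cat a b == g)
      tens << a >> << b >>) x.

Definition comul_heart_basis (g : vinc) : freeQ (vinc * vinc)%type :=
  let n := deg g in
  let s := (tagged g).1 in
  let sigma := (tagged g).2 in
  \sum_(A : {set 'I_n}) \sum_(A' : {set 'I_n} | A :|: A' == [set: 'I_n])
    \sum_(I : IP A) \sum_(I' : IP A' | glue (val I) (val I') == val s)
      tens << mk_vinc (std I) (st sigma A) >>
           << mk_vinc (std I') (st sigma A') >>.

Definition comul_heart (x : Hvinc) : freeQ (vinc * vinc)%type :=
  lin_ext comul_heart_basis x.

(* The restriction to degrees at most deg a + deg b loses no term; see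
   mcoeff_heart. *)
Definition heart_basis (a b : vinc) : Hvinc :=
  \sum_(g <- upto (deg a + deg b))
    pairing (tens << a >> << b >>) (comul_heart << g >>) *: << g >>.

Definition heart (x y : Hvinc) : Hvinc :=
  lin_ext (fun a => lin_ext (fun b => heart_basis a b) y) x.

Definition unit_vinc (c : rat) : Hvinc := c *: << vinc_e >>.

Definition counit_vinc (x : Hvinc) : rat := x@_vinc_e.

Definition homogeneous (n : nat) (x : Hvinc) : Prop :=
  forall b, b \in msupp x -> deg b = n.

Lemma mem_upto n (x : vinc) : (x \in upto n) = (deg x <= n)%N.
Proof.
apply/(allpairsPdep (T := fun k => (StIP k * 'S_k)%type))/idP.
  by case=> k [a [+ _ ->]]; rewrite mem_iota add0n ltnS.
case: x => k [s sigma] kn; exists k, (s, sigma).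
by split; rewrite ?mem_enum // mem_iota add0n ltnS.
Qed.

Lemma upto_uniq n : uniq (upto n).
Proof.
apply: (allpairs_uniq_dep (T := fun k => (StIP k * 'S_k)%type)); first exact: iota_uniq.
  by move=> k _; apply: enum_uniq.
move=> [k [s sigma]] [k' [s' sigma']] _ _ /= E.
exact: E.
Qed.

Lemma pairing_basis (K : choiceType) (k : K) (y : freeQ K) :
  pairing << k >> y = y@_k.
Proof. by rewrite /pairing msuppU oner_eq0 big_seq_fset1 mcoeffUU mul1r. Qed.

Lemma pairing_comul_black (a b g : vinc) :
  pairing (tens << a >> << b >>) (comul_black << g >>) =
  pairing (black << a >> << b >>) << g >>.
Proof.
rewrite tens_basis pairing_basis /comul_black /black !lin_extU pairing_basis.
rewrite mcoeffU raddf_sum /=.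
under eq_bigr => i _.
  rewrite raddf_sum /=.
  under eq_bigr => j _ do rewrite tens_basis mcoeffU xpair_eqE -mulnb natrM.
  over.
have [E|NE] := eqVneq (vinc_cat a b) g; last first.
  rewrite big1 // => i _; rewrite big1 // => j /eqP Ej.
  have [Ei|] := eqVneq i a; last by rewrite mul0r.
  have [Ej'|] := eqVneq j b; last by rewrite mulr0.
  by move: NE; rewrite -Ej Ei Ej' eqxx.
have dg : deg g = (deg a + deg b)%N by rewrite -E.
rewrite (bigD1_seq a) ?upto_uniq ?mem_upto ?dg ?leq_addr //= eqxx.
rewrite (big_rem b) ?mem_upto ?leq_addl //= E eqxx (eqxx b).
rewrite mulr1 big1_seq ?addr0; last first.
  move=> j /andP[_]; rewrite mem_rem_uniq ?upto_uniq // inE => /andP[/negbTE -> _].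
  by rewrite mulr0.
rewrite big1 ?addr0 // => i /negbTE ia.
by rewrite big1 // => j _; rewrite ia mul0r.
Qed.

Lemma mcoeff_heart (a b g : vinc) :
  (heart << a >> << b >>)@_g =
  pairing (tens << a >> << b >>) (comul_heart << g >>).
Proof.
rewrite /heart !lin_extU /heart_basis raddf_sum /=.
under eq_bigr => i _ do rewrite mcoeffZ mcoeffU.
have [le|lt] := leqP (deg g) (deg a + deg b).
  rewrite (bigD1_seq g) ?upto_uniq ?mem_upto //= (eqxx g).
  rewrite [X in X + _]mulr1 big1; first by rewrite addr0.
  by move=> i /negbTE ->; rewrite mulr0.
rewrite big1_seq; last first.
  move=> i /andP[_]; rewrite mem_upto => ile.
  have [E|] := eqVneq i g; last by rewrite mulr0.
  by rewrite E leqNgt lt in ile.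
rewrite tens_basis pairing_basis /comul_heart lin_extU.
rewrite !raddf_sum big1 //= => A _; rewrite raddf_sum big1 //= => A' /eqP AA'.
rewrite raddf_sum big1 //= => I _; rewrite raddf_sum big1 //= => I' _.
rewrite tens_basis mcoeffU.
case: eqP => // -[Ea Eb]; move: lt; rewrite -Ea -Eb /deg /= ltnNge.
have : (#|A :|: A'| <= #|A| + #|A'|)%N by rewrite cardsU leq_subr.
by rewrite AA' cardsT card_ord => ->.
Qed.

(* Main.v *)
(* An interval partition of a subset V of [n] is the same thing as a subgraph
   of the path 1 - 2 - ... - n with vertex set V: its edges (links) join
   consecutive elements lying in a common block. Under this dictionary gluing
   becomes the union of subgraphs, so the coproduct [comul_heart] is a sum over
   the pairs of subgraphs with a given union. Coassociativity and associativity
   of the two heart operations both reduce to the associativity of the union,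
   and compatibility with concatenation reduces to the fact that a subgraph of
   a disjoint union is a disjoint union of subgraphs.

   The second bialgebra is the graded dual of the first. Its antipode is the
   Neumann series of the convolution inverse of the identity; it is locally
   finite because [comul_black] preserves degrees. *)
From HB Require Import structures.
Require Import Defs.
From mathcomp Require Import all_boot all_order all_algebra all_fingroup.
From mathcomp Require Import finmap monalg zify.

Set Implicit Arguments.
Unset Strict Implicit.
Unset Printing Implicit Defensive.

Import GRing.Theory.
Local Open Scope ring_scope.

(** * Interval partitions as subgraphs of a path *)

(** The obstacle is dependent typing: [std] and [st] live over ['I_#|A|], so standardizing twice, or
    concatenating standardizations, produces elements over different types. A basis element is
    therefore observed only through its links and the relative order of its letters, and both are
    compared along increasing maps. Sums over decompositions take values in an arbitrary commutative
    monoid. With tensors as summands an identity is a law of the first bialgebra; with rational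
    summands it is a law for coefficients in the second. Each combinatorial identity is thus proved
    once, and duality enters only coefficientwise: the coefficient of [heart x y] at g is a sum over
    the decompositions of g, and that of [comul_black x] at (a, b) is the coefficient of x at
    [vinc_cat a b]. The two subgraphs of a decomposition may share vertices and edges, which is why
    [heart] is filtered rather than graded. *)

Section Links.
Variable n : nat.
Implicit Types (A B L : {set 'I_n}) (P I J : {set {set 'I_n}}) (i j k : 'I_n).

(** The successor is asked for as an element of B because i + 1 may fall outside ['I_n]. *)
Definition succ_in B i := [exists j in B, j == i.+1 :> nat].

Definition links P : {set 'I_n} :=
  [set i | [exists B in P, (i \in B) && succ_in B i]].

(** Connectedness in a path, written out: every edge between the two points is present. With [minn]
    and [maxn], symmetry is immediate and transitivity is arithmetic. *)
Definition linked L i j :=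
  [forall k : 'I_n, (minn i j <= k < maxn i j)%N ==> (k \in L)].

Definition legal A L := [forall i in L, (i \in A) && succ_in A i].

Definition ip_set A L := equivalence_partition (linked L) A.

Lemma succ_inP B i : reflect (exists2 j, j \in B & j = i.+1 :> nat) (succ_in B i).
Proof.
by apply: (iffP exists_inP) => -[j jB /eqP e]; exists j => //; apply/eqP.
Qed.

Lemma succ_inE B i j : j = i.+1 :> nat -> succ_in B i = (j \in B).
Proof.
move=> e; apply/succ_inP/idP => [[j' j'B e']|jB]; last by exists j.
by rewrite (_ : j = j') //; apply/val_inj; rewrite /= e.
Qed.

Lemma linksP P i :
  reflect (exists2 B, B \in P & (i \in B) && succ_in B i) (i \in links P).
Proof. by rewrite inE; apply: exists_inP. Qed.

Lemma linkedP L i j :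
  reflect (forall k, (minn i j <= k < maxn i j)%N -> k \in L) (linked L i j).
Proof. by apply: (iffP forallP) => h k; [apply/implyP|apply/implyP/h]. Qed.

Lemma linked_refl L i : linked L i i.
Proof. by apply/linkedP => k; lia. Qed.

Lemma linked_sym L i j : linked L i j = linked L j i.
Proof. by rewrite /linked minnC maxnC. Qed.

Lemma linked_trans L : transitive (linked L).
Proof.
move=> j i k /linkedP h1 /linkedP h2; apply/linkedP => x hx.
case: (boolP (minn i j <= x < maxn i j)%N) => [/h1 //|h].
by apply: h2; lia.
Qed.

Lemma linked_equiv A L : {in A & &, equivalence_rel (linked L)}.
Proof.
move=> i j k _ _ _; split; first exact: linked_refl.
move=> ij; apply/idP/idP; last exact: linked_trans.
by apply: linked_trans; rewrite linked_sym.
Qed.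

(** Induction along a path, in the form used below: membership in U only has to be propagated across
    single edges of L. *)
Lemma linked_closed (U : {set 'I_n}) L i j :
  (forall k l : 'I_n, k \in L -> l = k.+1 :> nat -> (k \in U) = (l \in U)) ->
  linked L i j -> (i \in U) = (j \in U).
Proof.
move=> cl.
have up d : forall i j : 'I_n, j = (i + d)%N :> nat -> linked L i j ->
    (i \in U) = (j \in U).
  elim: d => [|d IH] {}i {}j e /linkedP h.
    by rewrite (_ : j = i) //; apply: val_inj; rewrite /= e addn0.
  have ltk : (i + d < n)%N by have := ltn_ord j; lia.
  rewrite (IH i (Ordinal ltk)) //; last by apply/linkedP => k /= hk; apply: h; lia.
  by apply: cl; [apply: h => /=; lia | rewrite /=; lia].
move=> h; have [le|lt] := leqP i j; first by apply: (up (j - i)%N) => //; lia.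
by apply/esym; apply: (up (i - j)%N); [lia | rewrite linked_sym].
Qed.

Lemma legalP A L :
  reflect (forall i, i \in L -> i \in A /\ succ_in A i) (legal A L).
Proof.
apply: (iffP forall_inP) => h i /h; first by move/andP.
by case=> -> ->.
Qed.

Lemma legalU A A' L L' :
  legal A L -> legal A' L' -> legal (A :|: A') (L :|: L').
Proof.
move=> /legalP h /legalP h'; apply/legalP => i /setUP[/h|/h'] [iA /succ_inP[j jA e]];
by split; [|apply/succ_inP; exists j => //]; rewrite inE ?iA ?jA ?orbT.
Qed.

Lemma linked_mem A L i j : legal A L -> linked L i j -> (i \in A) = (j \in A).
Proof.
move=> /legalP lg; apply: linked_closed => k l /lg[-> sk] e.
by rewrite -(succ_inE A e) sk.
Qed.

Lemma block_ip_set A L B i : B \in ip_set A L -> i \in B ->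
  B = [set j in A | linked L i j].
Proof.
case/imsetP=> x xA ->; rewrite inE => /andP[iA xi]; apply/setP => j; rewrite !inE.
by case: (boolP (j \in A)) => //= jA; case: (@linked_equiv A L x i j xA iA jA) => _ ->.
Qed.

Lemma is_ip_set A L : legal A L -> is_ip A (ip_set A L).
Proof.
move=> lg; apply/andP; split.
  exact/equivalence_partitionP/linked_equiv.
apply/forall_inP => _ /imsetP[x xA ->].
have xx : x \in [set y in A | linked L x y] by rewrite inE xA linked_refl.
(* The component is the interval between its extremes a and b: any i in between is linked to a, and
   legality carries membership in A from a to i. *)
case: (arg_minnP (fun i : 'I_n => val i) xx) => a /setIdP[aA xa] mina.
case: (arg_maxnP (fun i : 'I_n => val i) xx) => b /setIdP[bA xb] maxb.
apply/existsP; exists a; apply/existsP; exists b; apply/eqP/setP => i.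
apply/idP/idP => [hi|].
  by rewrite inE; apply/andP; split; [exact: mina|exact: maxb].
rewrite inE => /andP[ai ib].
have ab : linked L a b by apply: linked_trans xb; rewrite linked_sym.
have ali : linked L a i.
  by apply/linkedP => k hk; move/linkedP: ab; apply; lia.
by rewrite inE -(linked_mem lg ali) aA (linked_trans xa ali).
Qed.

Lemma links_ip_set A L : legal A L -> links (ip_set A L) = L.
Proof.
move=> lg; apply/setP => i; apply/linksP/idP.
  case=> B BP /andP[iB]; rewrite (block_ip_set BP iB).
  case/succ_inP => j; rewrite inE => /andP[_ /linkedP h] e; apply: h; lia.
move=> iL; have /legalP/(_ _ iL)[iA /succ_inP[j jA e]] := lg.
exists [set j in A | linked L i j]; first exact: imset_f.
rewrite inE iA linked_refl; apply/succ_inP; exists j => //; rewrite inE jA.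
apply/linkedP => k hk; rewrite (_ : k = i) //; apply: val_inj => /=; lia.
Qed.

Lemma block_convex A I B i j k : is_ip A I -> B \in I -> i \in B -> k \in B ->
  (i <= j <= k)%N -> j \in B.
Proof.
case/andP=> _ /forall_inP h /h/existsP[a /existsP[b /eqP ->]].
by rewrite !inE; lia.
Qed.

Lemma block_sub A I B : is_ip A I -> B \in I -> B \subset A.
Proof. by case/andP=> /and3P[/eqP <- _ _] _; apply: bigcup_sup. Qed.

Lemma block_nonempty A I B : is_ip A I -> B \in I -> exists i, i \in B.
Proof.
case/andP=> /and3P[_ _ I0] _ BI; apply/set0Pn.
by apply: contraNneq I0 => <-.
Qed.

Lemma block_cover A I i : is_ip A I -> i \in A -> exists2 B, B \in I & i \in B.
Proof. by case/andP=> /and3P[/eqP <- _ _] _ /bigcupP. Qed.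

Lemma block_unique A I B C i : is_ip A I -> B \in I -> C \in I ->
  i \in B -> i \in C -> B = C.
Proof.
case/andP=> /and3P[_ /trivIsetP tr _] _ BI CI iB iC.
by apply/eqP/negPn/negP => /(tr _ _ BI CI)/pred0P/(_ i) /=; rewrite iB iC.
Qed.

Lemma legal_links A I : is_ip A I -> legal A (links I).
Proof.
move=> ip; apply/legalP => i /linksP[B BI /andP[iB /succ_inP[j jB e]]].
have /subsetP sub := block_sub ip BI.
by split; [apply: sub | apply/succ_inP; exists j => //; apply: sub].
Qed.

(** Blocks are components: convexity puts both ends of every edge between i and j into B, and
    conversely disjointness of the blocks prevents a link from leaving B. *)
Lemma block_linked A I B i j : is_ip A I -> B \in I -> i \in B ->
  (j \in B) = (j \in A) && linked (links I) i j.
Proof.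
move=> ip BI iB; apply/idP/andP => [jB|[jA ij]].
  split; first exact: (subsetP (block_sub ip BI)).
  wlog le : i j iB jB / (i <= j)%N.
    by move=> W; have [/W|/ltnW/W] := leqP i j; [|rewrite linked_sym]; apply.
  apply/linkedP => k hk; apply/linksP; exists B => //.
  rewrite (block_convex ip BI iB jB); last lia.
  have lt : (k.+1 < n)%N by have := ltn_ord j; lia.
  rewrite (@succ_inE _ k (Ordinal lt)) //.
  by rewrite (block_convex ip BI iB jB) //=; lia.
rewrite -(linked_closed _ ij) // => k l /linksP[C CI /andP[kC sC]] e.
have lC : l \in C by rewrite -(succ_inE C e).
by apply/idP/idP => h; rewrite (block_unique ip BI CI h).
Qed.

Lemma ip_set_links A I : is_ip A I -> ip_set A (links I) = I.
Proof.
move=> ip; apply/setP => B; apply/imsetP/idP.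
  case=> i iA ->; have [C CI iC] := block_cover ip iA.
  rewrite (_ : [set _ in _ | _] = C) //; apply/setP => j.
  by rewrite inE -(block_linked _ ip CI iC).
move=> BI; have [i iB] := block_nonempty ip BI.
exists i; first exact: (subsetP (block_sub ip BI)).
by apply/setP => j; rewrite inE -(block_linked _ ip BI iB).
Qed.

(** A chain of meeting blocks yields a path of links, since each block is connected and consecutive
    blocks share a point. Conversely each link lies inside one block, so the union of a class is
    closed under links. Hence a class is the component of any of its points. *)
Lemma glue_ip_set A A' I J : is_ip A I -> is_ip A' J ->
  glue I J = ip_set (A :|: A') (links I :|: links J).
Proof.
move=> ipI ipJ; rewrite /glue.
set meets := fun E F : {set 'I_n} => _; set L := links I :|: links J.
have blockL B i j : B \in I :|: J -> i \in B -> j \in B -> linked L i j.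
  case/setUP=> BIJ iB.
    rewrite (block_linked _ ipI BIJ iB) => /andP[_ /linkedP h].
    by apply/linkedP => k /h kI; apply/setUP; left.
  rewrite (block_linked _ ipJ BIJ iB) => /andP[_ /linkedP h].
  by apply/linkedP => k /h kJ; apply/setUP; right.
have blockA B : B \in I :|: J -> B \subset A :|: A'.
  case/setUP=> h; first by rewrite subsetU ?(block_sub ipI h).
  by rewrite subsetU ?(block_sub ipJ h) ?orbT.
have Acover i : i \in A :|: A' -> exists2 B, B \in I :|: J & i \in B.
  case/setUP.
    by case/(block_cover ipI) => B h iB; exists B => //; apply/setUP; left.
  by case/(block_cover ipJ) => B h iB; exists B => //; apply/setUP; right.
have key B i : B \in I :|: J -> i \in B ->
    \bigcup_(X in I :|: J | connect meets B X) X =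
    [set j in A :|: A' | linked L i j].
  move=> BIJ iB; set U := \bigcup_(X in _ | _) X; apply/setP => j.
  rewrite inE; apply/idP/andP.
    case/bigcupP=> X /andP[XIJ BX] jX.
    split; first exact: (subsetP (blockA X XIJ)).
    (* The base point varies with the block: a point k shared by B and the next block C takes the
       place of i. *)
    case/connectP: BX => p; elim: p B i BIJ iB {U} => [|C p IH] B i BIJ iB /=.
      by move=> _ XB; apply: (blockL X); rewrite // XB.
    case/andP=> /and3P[_ CIJ /set0Pn[k /setIP[kB kC]]] pth lst.
    by apply: linked_trans (IH _ _ CIJ kC pth lst); apply: (blockL B).
  case=> jA ij; rewrite -(linked_closed _ ij); last first.
    move=> k l kL e.
    have [B' B'IJ /andP[kB' sB']] : exists2 B, B \in I :|: J & (k \in B) && succ_in B k.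
      by case/setUP: kL => /linksP[B' h h']; exists B' => //; rewrite inE h ?orbT.
    have lB' : l \in B' by rewrite -(succ_inE B' e).
    have mem x y : x \in B' -> y \in B' -> x \in U -> y \in U.
      move=> xB' yB' /bigcupP[X /andP[XIJ BX] xX]; apply/bigcupP.
      exists B' => //; rewrite B'IJ; apply: connect_trans BX (connect1 _).
      by rewrite /meets XIJ B'IJ; apply/set0Pn; exists x; rewrite inE xX.
    by apply/idP/idP; apply: mem.
  by apply/bigcupP; exists B; rewrite ?BIJ ?connect0.
apply/setP => B; apply/imsetP/imsetP => -[].
  move=> C CIJ ->.
  have [i iC] : exists i, i \in C.
    by case/setUP: CIJ; [apply: (block_nonempty ipI)|apply: (block_nonempty ipJ)].
  by exists i; [apply: (subsetP (blockA C CIJ)) | apply: key].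
move=> i /Acover[C CIJ iC] ->.
by exists C => //; rewrite (key C i).
Qed.

End Links.

(** * Standardized subgraphs *)

Section Enum.
Variables (p n : nat).

Lemma card_ord_lt (i : 'I_p) : #|[set k : 'I_p | (k < i)%N]| = i.
Proof.
rewrite -sum1dep_card -(big_ord_widen _ (fun=> 1%N)) ?sum1_card ?card_ord //.
exact: ltnW.
Qed.

Lemma rank_mono (V : {set 'I_n}) (f : 'I_p -> 'I_n) i :
  (forall i j : 'I_p, (f i < f j)%N = (i < j)%N) -> V = f @: [set: 'I_p] ->
  #|[set v in V | (v < f i)%N]| = i.
Proof.
move=> mono ->; rewrite -[RHS]card_ord_lt.
have inj : injective f.
  move=> a b ab; have := mono a b; have := mono b a.
  by rewrite ab ltnn => h1 h2; apply: val_inj => /=; lia.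
rewrite -(card_imset _ inj); congr #|pred_of_set _|; apply/setP => v.
rewrite inE; apply/andP/imsetP => [[/imsetP[k _ ->]]|[k]].
  by rewrite mono => h; exists k; rewrite ?inE.
by rewrite inE => h ->; rewrite imset_f ?inE // mono.
Qed.

End Enum.

Lemma enum_val_setT n (V : {set 'I_n}) : V = [set enum_val i | i in [set: 'I_#|V|]].
Proof.
apply/setP => v; apply/idP/imsetP => [vV|[i _ ->]]; last exact: enum_valP.
by exists (enum_rank_in vV v); rewrite ?inE ?enum_rankK_in.
Qed.

(** Uniqueness of the increasing enumeration: both values have the same rank in V. The indices live
    in different types and are compared as natural numbers. *)
Lemma enum_val_mono p n (V : {set 'I_n}) (f : 'I_p -> 'I_n)
    (i : 'I_p) (j : 'I_#|V|) :
  (forall i j : 'I_p, (f i < f j)%N = (i < j)%N) -> V = f @: [set: 'I_p] ->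
  i = j :> nat -> enum_val j = f i.
Proof.
move=> mono fV ij; have := enum_valP j; rewrite {2}fV => /imsetP[k _ e].
have := rank_mono j (@ltn_enum_val _ V) (enum_val_setT V).
rewrite e (rank_mono k mono fV) => kj.
by congr f; apply: val_inj; rewrite /= kj ij.
Qed.

(** A letter equals the number of letters below it, so the relative order recovers the
    permutation. *)
Lemma perm_order_ext n (s t : 'S_n) :
  (forall i j, (s i < s j)%N = (t i < t j)%N) -> s = t.
Proof.
move=> st; have rank (u : 'S_n) i : #|[set j | (u j < u i)%N]| = u i.
  rewrite -[RHS]card_ord_lt -(card_imset [set j | _] (@perm_inj _ u)).
  congr #|pred_of_set _|; apply/setP => k; rewrite inE -(permKV u k).
  by rewrite mem_imset ?inE //; apply: perm_inj.
apply/permP => i; apply: val_inj; rewrite /= -(rank s) -(rank t).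
by congr #|pred_of_set _|; apply/setP => j; rewrite !inE st.
Qed.

Definition vlinks (x : vinc) : {set 'I_(deg x)} := links (val (tagged x).1).

Definition vperm (x : vinc) : 'S_(deg x) := (tagged x).2.

Lemma is_ipT (x : vinc) : is_ip [set: 'I_(deg x)] (val (tagged x).1).
Proof. exact: valP. Qed.

(** Extensionality for the dependent pair: the transport between degrees is confined to [cast_ord],
    which leaves the underlying numbers unchanged. *)
Lemma vinc_ext (x y : vinc) (h : deg x = deg y) :
  (forall i, (i \in vlinks x) = (cast_ord h i \in vlinks y)) ->
  (forall i j, (vperm x i < vperm x j)%N =
     (vperm y (cast_ord h i) < vperm y (cast_ord h j))%N) ->
  x = y.
Proof.
case: x h => n [s sigma]; case: y => m [t tau] h.
have h' : n = m := h.
case: m / h' t tau h => t tau h lk pm.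
have -> : s = t.
  apply: val_inj; rewrite -(ip_set_links (valP s)) -(ip_set_links (valP t)).
  by congr ip_set; apply/setP => i; have := lk i; rewrite cast_ord_id.
have -> // : sigma = tau.
by apply: perm_order_ext => i j; have := pm i j; rewrite !cast_ord_id.
Qed.

(* A pair (V, L) with [legal V L] is a subgraph of the path 1 - 2 - ... - n:
   V is its vertex set and i in L stands for the edge from i to i + 1. *)
Definition subgr n := ({set 'I_n} * {set 'I_n})%type.

Definition legalp n (X : subgr n) := legal X.1 X.2.

(** Makes [ip_of] total, so that sums can range over all pairs of sets, with legality as a
    filter. *)
Definition trim n (A L : {set 'I_n}) := [set i in L | (i \in A) && succ_in A i].

Lemma legal_trim n (A L : {set 'I_n}) : legal A (trim A L).
Proof. by apply/legalP => i; rewrite inE => /and3P[]. Qed.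

Lemma trim_legal n (A L : {set 'I_n}) : legal A L -> trim A L = L.
Proof.
move/legalP => h; apply/setP => i; rewrite inE.
by case: (boolP (i \in L)) => //= /h[-> ->].
Qed.

Definition ip_of n (A L : {set 'I_n}) : IP A :=
  Sub (ip_set A (trim A L)) (is_ip_set (legal_trim A L)).

Definition sub_vinc (g : vinc) (X : subgr (deg g)) : vinc :=
  mk_vinc (std (ip_of X.1 X.2)) (st (vperm g) X.1).

(** Standardizing can make distant points adjacent, but not at an edge of L: there the successor in
    [n] already lies in A, with nothing in between. *)
Lemma succ_enum_val n (A L : {set 'I_n}) (i j : 'I_#|A|) :
  legal A L -> enum_val i \in L ->
  (enum_val j == (enum_val i).+1 :> nat) = (j == i.+1 :> nat).
Proof.
move=> /legalP/(_ (enum_val i)) lg /lg[_ /succ_inP[k kA e]].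
have kE := enum_rankK_in kA kA; set l := enum_rank_in kA k in kE.
have il : (i < l)%N by rewrite -ltn_enum_val kE e.
have {}kE : l = i.+1 :> nat.
  have [//|ne] := eqVneq (val l) i.+1.
  have lt : (i.+1 < #|A|)%N := leq_ltn_trans il (ltn_ord l).
  have h1 : (enum_val i < enum_val (Ordinal lt))%N by rewrite ltn_enum_val.
  have : (enum_val (Ordinal lt) < enum_val l)%N.
    by rewrite ltn_enum_val /= ltn_neqAle eq_sym ne.
  by rewrite kE e ltnS leqNgt h1.
by rewrite -kE -e -(enum_rankK_in kA kA) -/l !val_eqE (inj_eq enum_val_inj).
Qed.

Lemma vlinks_sub_vinc g (X : subgr (deg g)) (i : 'I_#|X.1|) : legalp X ->
  (i \in vlinks (sub_vinc X)) = (enum_val i \in X.2).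
Proof.
case: X i => V L /= i lg; rewrite /vlinks /= (trim_legal lg).
apply/linksP/idP.
  case=> _ /imsetP[C CP ->]; rewrite inE => /andP[iC /succ_inP[j]].
  rewrite inE (block_ip_set CP iC) inE => /andP[_ /linkedP h] e; apply: h.
  have lt : (enum_val i < enum_val j)%N by rewrite ltn_enum_val e.
  by rewrite geq_minl leq_max lt orbT.
move=> iL; have /legalP/(_ _ iL)[iV /succ_inP[k kV e]] := lg.
pose C := [set y in V | linked L (enum_val i) y].
exists [set j : 'I_#|V| | enum_val j \in C]; first exact/imset_f/imset_f.
rewrite !inE iV linked_refl /=; apply/succ_inP.
have kE := enum_rankK_in kV kV; exists (enum_rank_in kV k).
  rewrite !inE kE kV /=; apply/linkedP => l hl.
  by rewrite (_ : l = enum_val i) //; apply: val_inj => /=; lia.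
by apply/eqP; rewrite -(succ_enum_val _ lg iL) kE e.
Qed.

Lemma vperm_sub_vinc g (X : subgr (deg g)) (i j : 'I_#|X.1|) :
  (vperm (sub_vinc X) i < vperm (sub_vinc X) j)%N =
  (vperm g (enum_val i) < vperm g (enum_val j))%N.
Proof. exact: st_lt. Qed.

(* All identities between standardizations are checked on the unique
   increasing parametrization of the vertex set. *)
Lemma sub_vinc_eq (g x : vinc) (X : subgr (deg g)) (f : 'I_(deg x) -> 'I_(deg g)) :
  legalp X ->
  (forall i j, (f i < f j)%N = (i < j)%N) -> X.1 = f @: [set: 'I_(deg x)] ->
  (forall i, (i \in vlinks x) = (f i \in X.2)) ->
  (forall i j, (vperm x i < vperm x j)%N = (vperm g (f i) < vperm g (f j))%N) ->
  x = sub_vinc X.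
Proof.
move=> lg mono fV lk pm.
have inj : injective f.
  move=> a b ab; have := mono a b; have := mono b a.
  by rewrite ab ltnn => h1 h2; apply: val_inj => /=; lia.
have h : deg x = deg (sub_vinc X).
  by rewrite /deg /= fV card_imset // cardsT card_ord.
have ev i : enum_val (cast_ord h i) = f i by apply: enum_val_mono.
apply: (vinc_ext (h := h)) => [i|i j].
  by rewrite vlinks_sub_vinc // ev lk.
by rewrite vperm_sub_vinc !ev pm.
Qed.

Definition full (g : vinc) : subgr (deg g) := ([set: 'I_(deg g)], vlinks g).

Lemma legal_full g : legalp (full g).
Proof. exact: legal_links (is_ipT g). Qed.

Lemma sub_vinc_full g : sub_vinc (full g) = g.
Proof.
symmetry; apply: (sub_vinc_eq (f := id)) => //; first exact: legal_full.
by rewrite imset_id.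
Qed.

Lemma deg0_vinc_e g : deg g = 0%N -> g = vinc_e.
Proof.
move=> h; apply: (@vinc_ext g vinc_e h) => i.
  by have := ltn_ord (cast_ord h i).
by have := ltn_ord (cast_ord h i).
Qed.

(** Successors are required to be preserved only at points of L; for [enum_val] this is what
    [succ_enum_val] provides. *)
Lemma legal_imset p n (f : 'I_p -> 'I_n) (A L : {set 'I_p}) :
  injective f ->
  (forall i j, i \in L ->
    (f j == (f i).+1 :> nat) = (j == i.+1 :> nat)) ->
  legal (f @: A) (f @: L) = legal A L.
Proof.
move=> inj fS; apply/legalP/legalP => h i.
  move=> iL; have [] := h (f i) (imset_f f iL); rewrite mem_imset // => iA.
  case/succ_inP=> _ /imsetP[j jA ->] /eqP; rewrite fS // => /eqP e.
  by split=> //; apply/succ_inP; exists j.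
case/imsetP=> {}i iL ->; have [iA /succ_inP[j jA /eqP e]] := h i iL.
split; first exact: imset_f.
by apply/succ_inP; exists (f j); [apply: imset_f | apply/eqP; rewrite fS].
Qed.

Definition imset_subgr p n (f : 'I_p -> 'I_n) (Y : subgr p) : subgr n :=
  (f @: Y.1, f @: Y.2).

Section SubSub.
Variables (g : vinc) (X : subgr (deg g)).
Hypothesis lX : legalp X.
Let ev : 'I_(deg (sub_vinc X)) -> 'I_(deg g) := enum_val (A := mem X.1).

(** The inclusion rules out edges of Y between points that became adjacent only through
    standardization. *)
Lemma legal_sub_sub (Y : subgr (deg (sub_vinc X))) :
  Y.2 \subset vlinks (sub_vinc X) -> legalp (imset_subgr ev Y) = legalp Y.
Proof.
move=> /subsetP sY; apply: legal_imset => [|i j /sY]; first exact: enum_val_inj.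
by rewrite vlinks_sub_vinc //; apply: succ_enum_val.
Qed.

(** Standardizing in two stages agrees with standardizing once, because a composite of increasing
    enumerations is again increasing. *)
Lemma sub_vinc_sub (Y : subgr (deg (sub_vinc X))) :
  legalp Y -> Y.2 \subset vlinks (sub_vinc X) ->
  sub_vinc Y = sub_vinc (imset_subgr ev Y).
Proof.
move=> lY sY; have evi : injective ev by apply: enum_val_inj.
apply: (@sub_vinc_eq g (sub_vinc Y) _ (fun i : 'I_#|Y.1| => ev (enum_val i))).
- by rewrite legal_sub_sub.
- by move=> i j; rewrite !ltn_enum_val.
- rewrite /= {1}(enum_val_setT Y.1); apply/setP => v; apply/imsetP/imsetP.
    by case=> _ /imsetP[i _ ->] ->; exists i; rewrite ?inE.
  by case=> i _ ->; exists (enum_val i); rewrite ?imset_f ?inE.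
- by move=> i; rewrite vlinks_sub_vinc // mem_imset.
- by move=> i j; rewrite !vperm_sub_vinc.
Qed.

End SubSub.

(** * Concatenation *)

Lemma links_setU n (P Q : {set {set 'I_n}}) :
  links (P :|: Q) = links P :|: links Q.
Proof.
apply/setP => i; apply/linksP/setUP.
  by case=> B /setUP[] BP h; [left | right]; apply/linksP; exists B.
by case=> /linksP[B BP h]; exists B; rewrite // inE BP ?orbT.
Qed.

Lemma links_imset p n (f : 'I_p -> 'I_n) (P : {set {set 'I_p}}) :
  injective f ->
  (forall i j, (f j == (f i).+1 :> nat) = (j == i.+1 :> nat)) ->
  links [set f @: (B : {set 'I_p}) | B in P] = f @: links P.
Proof.
move=> inj fS; apply/setP => x; apply/linksP/imsetP.
  case=> _ /imsetP[B BP ->] /andP[/imsetP[i iB ->]].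
  case/succ_inP=> _ /imsetP[j jB ->] /eqP; rewrite fS => /eqP e.
  exists i => //; apply/linksP; exists B; rewrite // iB.
  by apply/succ_inP; exists j.
case=> i /linksP[B BP /andP[iB /succ_inP[j jB /eqP e]]] ->.
exists (f @: B); first exact: imset_f.
rewrite imset_f //; apply/succ_inP; exists (f j); first exact: imset_f.
by apply/eqP; rewrite fS.
Qed.

Section Split.
Variables m n : nat.
Implicit Types (A : {set 'I_m}) (B : {set 'I_n}).

Definition set_cat A B : {set 'I_(m + n)} := (lshift n @: A) :|: (@rshift m n @: B).

Lemma lshiftS (i j : 'I_m) :
  (lshift n j == (lshift n i).+1 :> nat) = (j == i.+1 :> nat).
Proof. by []. Qed.

Lemma rshiftS (i j : 'I_n) :
  (rshift m j == (rshift m i).+1 :> nat) = (j == i.+1 :> nat).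
Proof. by rewrite /= -addnS eqn_add2l. Qed.

Lemma mem_set_catl A B i : (lshift n i \in set_cat A B) = (i \in A).
Proof.
rewrite inE (mem_imset _ _ (@lshift_inj m n)) orbC.
by case: imsetP => //= -[j _ /eqP]; rewrite eq_lrshift.
Qed.

Lemma mem_set_catr A B i : (rshift m i \in set_cat A B) = (i \in B).
Proof.
rewrite inE (mem_imset _ _ (@rshift_inj m n)).
by case: imsetP => //= -[j _ /eqP]; rewrite eq_rlshift.
Qed.

Lemma set_cat_eqP (S T : {set 'I_(m + n)}) :
  (forall i, (lshift n i \in S) = (lshift n i \in T)) ->
  (forall i, (rshift m i \in S) = (rshift m i \in T)) -> S = T.
Proof. by move=> hl hr; apply/setP => i; rewrite -(splitK i); case: split. Qed.

Lemma set_catT : set_cat [set: 'I_m] [set: 'I_n] = [set: 'I_(m + n)].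
Proof. by apply: set_cat_eqP => i; rewrite ?mem_set_catl ?mem_set_catr !inE. Qed.

Lemma set_catU A A' B B' :
  set_cat A B :|: set_cat A' B' = set_cat (A :|: A') (B :|: B').
Proof.
by apply: set_cat_eqP => i; rewrite inE ?mem_set_catl ?mem_set_catr inE.
Qed.

Lemma set_catK (S : {set 'I_(m + n)}) :
  set_cat (lshift n @^-1: S) (@rshift m n @^-1: S) = S.
Proof. by apply: set_cat_eqP => i; rewrite ?mem_set_catl ?mem_set_catr inE. Qed.

Lemma preim_set_catl A B : lshift n @^-1: set_cat A B = A.
Proof. by apply/setP => i; rewrite inE mem_set_catl. Qed.

Lemma preim_set_catr A B : @rshift m n @^-1: set_cat A B = B.
Proof. by apply/setP => i; rewrite inE mem_set_catr. Qed.

(** The bound on L excludes the edge across the junction, which could be legal in the concatenation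
    but never in the left factor. *)
Lemma legal_set_cat A (L : {set 'I_m}) B (M : {set 'I_n}) :
  (forall i, i \in L -> (i.+1 < m)%N) ->
  legal (set_cat A B) (set_cat L M) = legal A L && legal B M.
Proof.
move=> hL.
rewrite -(@legal_imset _ _ _ A L (@lshift_inj m n) (fun i j _ => lshiftS i j)).
rewrite -(@legal_imset _ _ _ B M (@rshift_inj m n) (fun i j _ => rshiftS i j)).
apply/idP/andP => [h|[]]; last exact: legalU.
split; apply/legalP => _ /imsetP[i iL ->].
  have /legalP/(_ (lshift n i)) := h; rewrite !mem_set_catl => /(_ iL)[iA].
  rewrite (@succ_inE _ _ _ (lshift n (Ordinal (hL i iL)))) // mem_set_catl => jA.
  split; first exact: imset_f.
  by apply/succ_inP; exists (lshift n (Ordinal (hL i iL))); rewrite ?imset_f.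
have /legalP/(_ (rshift m i)) := h; rewrite !mem_set_catr => /(_ iL)[iB].
case/succ_inP=> j; rewrite -(splitK j); case: (split j) => {}j /= jB e.
  by have := ltn_ord j; rewrite e; lia.
rewrite mem_set_catr in jB.
split; first exact: imset_f.
by apply/succ_inP; exists (rshift m j); rewrite ?imset_f.
Qed.

End Split.

Lemma vlinks_cat x y : vlinks (vinc_cat x y) = set_cat (vlinks x) (vlinks y).
Proof.
rewrite /vlinks /= /ip_cat_set links_setU !links_imset //.
- exact: rshift_inj.
- exact: rshiftS.
- exact: lshift_inj.
Qed.

Lemma vlinks_bound g i : i \in vlinks g -> (i.+1 < deg g)%N.
Proof.
have /legalP h := legal_full g.
by case/h => _ /succ_inP[j _ e]; have := ltn_ord j; rewrite e.
Qed.

Lemma vperm_catl x y i :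
  vperm (vinc_cat x y) (lshift (deg y) i) = lshift (deg y) (vperm x i).
Proof. by rewrite permE /perm_cat_fun (unsplitK (inl i)). Qed.

Lemma vperm_catr x y i :
  vperm (vinc_cat x y) (rshift (deg x) i) = rshift (deg x) (vperm y i).
Proof. by rewrite permE /perm_cat_fun (unsplitK (inr i)). Qed.

Definition subgr_cat m n (X : subgr m) (Y : subgr n) : subgr (m + n) :=
  (set_cat X.1 Y.1, set_cat X.2 Y.2).

Lemma full_cat g h : full (vinc_cat g h) = subgr_cat (full g) (full h).
Proof. by rewrite /full /subgr_cat vlinks_cat set_catT. Qed.

Lemma legal_subgr_cat g h (X : subgr (deg g)) (Y : subgr (deg h)) :
  X.2 \subset vlinks g -> legalp (subgr_cat X Y) = legalp X && legalp Y.
Proof.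
move=> /subsetP sX; apply: legal_set_cat => i /sX; exact: vlinks_bound.
Qed.

Lemma sub_vinc_cat g h (X : subgr (deg g)) (Y : subgr (deg h)) :
  legalp X -> legalp Y -> X.2 \subset vlinks g ->
  vinc_cat (sub_vinc X) (sub_vinc Y) =
  @sub_vinc (vinc_cat g h) (subgr_cat X Y).
Proof.
move=> lX lY sX.
(* The juxtaposition of the two enumerations is the increasing enumeration of the vertices of
   [subgr_cat X Y]. *)
pose f (i : 'I_(#|X.1| + #|Y.1|)) : 'I_(deg g + deg h) :=
  match split i with
  | inl j => lshift _ (enum_val j)
  | inr j => rshift _ (enum_val j)
  end.
have fl i : f (lshift _ i) = lshift _ (enum_val i) by rewrite /f (unsplitK (inl i)).
have fr i : f (rshift _ i) = rshift _ (enum_val i) by rewrite /f (unsplitK (inr i)).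
apply: (@sub_vinc_eq (vinc_cat g h) (vinc_cat (sub_vinc X) (sub_vinc Y)) _ f).
- by rewrite legal_subgr_cat ?lX.
- move=> i j; rewrite -(splitK i) -(splitK j).
  case: (split i) (split j) => {}i [] {}j /=; rewrite ?fl ?fr /=.
  + exact: ltn_enum_val.
  + by rewrite !ltn_addr.
  + by rewrite [LHS]ltnNge ltnW ?ltn_addr //= ltnNge ltnW ?ltn_addr.
  + by rewrite !ltn_add2l ltn_enum_val.
- apply: set_cat_eqP => i; rewrite ?mem_set_catl ?mem_set_catr.
    apply/idP/imsetP => [iX|[j _]].
      exists (lshift _ (enum_rank_in iX i)); rewrite ?inE // fl.
      by rewrite enum_rankK_in.
    rewrite -(splitK j); case: (split j) => {}j /=; rewrite ?fl ?fr.
      by move/lshift_inj->; apply: enum_valP.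
    by move/eqP; rewrite eq_lrshift.
  apply/idP/imsetP => [iX|[j _]].
    exists (rshift _ (enum_rank_in iX i)); rewrite ?inE // fr.
    by rewrite enum_rankK_in.
  rewrite -(splitK j); case: (split j) => {}j /=; rewrite ?fl ?fr.
    by move/eqP; rewrite eq_rlshift.
  by move/rshift_inj->; apply: enum_valP.
- move=> i; rewrite vlinks_cat -(splitK i); case: (split i) => {}i /=.
    by rewrite fl !mem_set_catl vlinks_sub_vinc.
  by rewrite fr !mem_set_catr vlinks_sub_vinc.
- have pl (k : 'I_#|X.1|) : vperm (vinc_cat (sub_vinc X) (sub_vinc Y))
      (lshift #|Y.1| k) = vperm (sub_vinc X) k :> nat.
    exact: (congr1 val (@vperm_catl (sub_vinc X) (sub_vinc Y) k)).
  have pr (k : 'I_#|Y.1|) : vperm (vinc_cat (sub_vinc X) (sub_vinc Y))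
      (rshift #|X.1| k) = (#|X.1| + vperm (sub_vinc Y) k)%N :> nat.
    exact: (congr1 val (@vperm_catr (sub_vinc X) (sub_vinc Y) k)).
  move=> i j; rewrite -(splitK i) -(splitK j).
  case: (split i) (split j) => {}i [] {}j /=;
    rewrite ?fl ?fr ?pl ?pr ?vperm_catl ?vperm_catr /=.
  + exact: vperm_sub_vinc.
  + by rewrite !ltn_addr.
  + by rewrite [LHS]ltnNge ltnW ?ltn_addr //= ltnNge ltnW ?ltn_addr.
  + by rewrite !ltn_add2l vperm_sub_vinc.
Qed.

Lemma vinc_catA : associative vinc_cat.
Proof.
move=> a b c.
have h : deg (vinc_cat a (vinc_cat b c)) = deg (vinc_cat (vinc_cat a b) c).
  exact: addnA.
have hl i : cast_ord h (lshift _ i) = lshift _ (lshift _ i) by apply: val_inj.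
have hm i : cast_ord h (rshift _ (lshift _ i)) = lshift _ (rshift _ i).
  exact: val_inj.
have hr i : cast_ord h (rshift _ (rshift _ i)) = rshift _ i.
  by apply: val_inj; rewrite /= addnA.
have spl (P : 'I_(deg a + (deg b + deg c)) -> Prop) :
    (forall i, P (lshift _ i)) -> (forall i, P (rshift _ (lshift _ i))) ->
    (forall i, P (rshift _ (rshift _ i))) -> forall i, P i.
  move=> Pl Pm Pr i; rewrite -(splitK i); case: (split i) => {}i //=.
  by rewrite -(splitK i); case: (split i) => {}i /=.
have pv : forall i, vperm (vinc_cat (vinc_cat a b) c) (cast_ord h i) =
    vperm (vinc_cat a (vinc_cat b c)) i :> nat.
  apply: (spl _) => i; rewrite ?hl ?hm ?hr ?vperm_catl ?vperm_catr
    ?vperm_catl ?vperm_catr //=.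
  by rewrite addnA.
apply: (vinc_ext (h := h)) => [|i j]; last by rewrite !pv.
by apply: (spl _) => i; rewrite ?hl ?hm ?hr !vlinks_cat
  ?mem_set_catl ?mem_set_catr ?mem_set_catl ?mem_set_catr.
Qed.

Lemma vinc_cat0 : right_id vinc_e vinc_cat.
Proof.
move=> x; have h : deg (vinc_cat x vinc_e) = deg x by apply: addn0.
have spl (P : 'I_(deg x + deg vinc_e) -> Prop) :
    (forall i, P (lshift _ i)) -> forall i, P i.
  by move=> Pl i; rewrite -(splitK i); case: (split i) => //= -[].
have hl i : cast_ord h (lshift _ i) = i by apply: val_inj.
apply: (vinc_ext (h := h)).
  by apply: (spl _) => i; rewrite hl vlinks_cat mem_set_catl.
by apply: (spl _) => i; apply: (spl _) => j; rewrite !hl !vperm_catl.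
Qed.

Lemma vinc_0cat : left_id vinc_e vinc_cat.
Proof.
move=> x; have h : deg (vinc_cat vinc_e x) = deg x by [].
have spl (P : 'I_(deg vinc_e + deg x) -> Prop) :
    (forall i, P (rshift _ i)) -> forall i, P i.
  by move=> Pl i; rewrite -(splitK i); case: (split i) => //= -[].
have hl i : cast_ord h (rshift _ i) = i by apply: val_inj.
apply: (vinc_ext (h := h)).
  by apply: (spl _) => i; rewrite hl vlinks_cat mem_set_catr.
by apply: (spl _) => i; apply: (spl _) => j; rewrite !hl !vperm_catr.
Qed.

(** * Sums over decompositions into two subgraphs *)

Section Join.
Variable n : nat.
Implicit Types X Y Z : subgr n.

Definition join X Y : subgr n := (X.1 :|: Y.1, X.2 :|: Y.2).

Definition dec X (P : subgr n * subgr n) :=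
  [&& legalp P.1, legalp P.2 & join P.1 P.2 == X].

Lemma joinA : associative join.
Proof. by move=> X Y Z; rewrite /join !setUA. Qed.

Lemma legal_join X Y : legalp X -> legalp Y -> legalp (join X Y).
Proof. exact: legalU. Qed.

Lemma dec_sub X P : dec X P ->
  [/\ P.1.1 \subset X.1, P.1.2 \subset X.2, P.2.1 \subset X.1 & P.2.2 \subset X.2].
Proof. by case/and3P=> _ _ /eqP<-; rewrite !subsetUl !subsetUr. Qed.

(** Both sides run over the triples of legal subgraphs with join X: the intermediate subgraph is
    determined as a join of two of them, and is then legal. *)
Lemma sum_dec_assoc (V : nmodType) X (F : subgr n -> subgr n -> subgr n -> V) :
  \sum_(P | dec X P) \sum_(Q | dec P.1 Q) F Q.1 Q.2 P.2 =
  \sum_(P | dec X P) \sum_(Q | dec P.2 Q) F P.1 Q.1 Q.2.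
Proof.
rewrite !pair_big_dep /=.
rewrite (reindex_onto
  (fun T : subgr n * (subgr n * subgr n) =>
     ((join T.1 T.2.1, T.2.2), (T.1, T.2.1)))
  (fun R => (R.2.1, (R.2.2, R.1.2)))) /=; last first.
  by case=> [[A B] [C D]]; rewrite /dec /= => /andP[_ /and3P[_ _ /eqP ->]].
rewrite [RHS](reindex_onto
  (fun T : subgr n * (subgr n * subgr n) =>
     ((T.1, join T.2.1 T.2.2), T.2))
  (fun R => (R.1.1, R.2))) /=; last first.
  by case=> [[A B] [C D]]; rewrite /dec /= => /andP[_ /and3P[_ _ /eqP ->]].
apply: eq_big => [[A [B C]]|[A [B C]] _]; last by [].
rewrite /dec /= !eqxx !andbT joinA.
have [lA|_] := boolP (legalp A); last by rewrite /= !andbF.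
have [lB|_] := boolP (legalp B); last by rewrite /= !andbF.
have [lC|_] := boolP (legalp C); last by rewrite /= !andbF.
by rewrite !legal_join.
Qed.

End Join.

(** The coproduct with its tensors replaced by an arbitrary G, so that it also expresses
    coefficients of the dual product. *)
Definition split_sum (V : nmodType) (g : vinc) (G : vinc -> vinc -> V) : V :=
  \sum_(P : subgr (deg g) * subgr (deg g) | dec (full g) P)
    G (sub_vinc P.1) (sub_vinc P.2).

(** Images and preimages under the enumeration of X match decompositions of the standardization with
    decompositions of X itself, so iterated splitting never leaves the path of g. *)
Lemma split_sum_sub (V : nmodType) g (X : subgr (deg g)) (G : vinc -> vinc -> V) :
  legalp X ->
  split_sum (sub_vinc X) G =
  \sum_(P | dec X P) G (sub_vinc P.1) (sub_vinc P.2).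
Proof.
move=> lX; pose ev : 'I_(deg (sub_vinc X)) -> 'I_(deg g) := enum_val (A := mem X.1).
have evi : injective ev by apply: enum_val_inj.
have evP i : ev i \in X.1 by apply: enum_valP.
pose pre (Y : subgr (deg g)) : subgr (deg (sub_vinc X)) := (ev @^-1: Y.1, ev @^-1: Y.2).
have preK (Y : subgr (deg g)) : Y.1 \subset X.1 -> Y.2 \subset X.2 ->
    imset_subgr ev (pre Y) = Y.
  have im (S : {set 'I_(deg g)}) : S \subset X.1 -> ev @: (ev @^-1: S) = S.
    move=> /subsetP sS; apply/setP => i; apply/imsetP/idP.
      by case=> j; rewrite inE => jS ->.
    move=> iS; have iX := sS i iS.
    by exists (enum_rank_in iX i); rewrite ?inE /ev enum_rankK_in.
  move=> s1 s2; case: Y s1 s2 => V1 L /= s1 s2; rewrite /imset_subgr /= !im //.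
  apply: subset_trans s2 _; apply/subsetP => i iL.
  by have /legalP/(_ i iL)[] := lX.
have imK Y : pre (imset_subgr ev Y) = Y.
  by case: Y => V1 L; congr pair; apply/setP => i; rewrite inE mem_imset.
have im_full : imset_subgr ev (full (sub_vinc X)) = X.
  rewrite -[RHS]preK //; congr imset_subgr; congr pair.
    by apply/setP => i; rewrite !inE evP.
  by apply/setP => i; rewrite [RHS]inE vlinks_sub_vinc.
have imJ Y Z : imset_subgr ev (join Y Z) = join (imset_subgr ev Y) (imset_subgr ev Z).
  by rewrite /imset_subgr /join /= !imsetU.
have im_inj : injective (imset_subgr ev) by apply: can_inj imK.
rewrite [RHS](reindex_onto
  (fun P => (imset_subgr ev P.1, imset_subgr ev P.2))
  (fun P => (pre P.1, pre P.2))) /=; last first.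
  by case=> A B /dec_sub /= [a1 a2 b1 b2]; rewrite !preK.
apply: eq_big => -[A B] /=.
  rewrite !imK eqxx andbT /dec /= -imJ.
  have <- : (join A B == full (sub_vinc X)) = (imset_subgr ev (join A B) == X).
    by rewrite -(inj_eq im_inj) im_full.
  (* The join equation comes first: it places the edges of A and B among the links, where legality
     transfers. *)
  case: (join A B =P full (sub_vinc X)) => [e|_]; last by rewrite !andbF.
  have [sA sB] : A.2 \subset vlinks (sub_vinc X) /\ B.2 \subset vlinks (sub_vinc X).
    by have /(congr1 snd) /= <- := e; rewrite subsetUl subsetUr.
  by rewrite !legal_sub_sub.
move=> h; have /dec_sub /= [_ sA _ sB] := h.
by case/and3P: h => lA lB _; rewrite !sub_vinc_sub.
Qed.

Lemma split_sum_assoc (V : nmodType) g (F : vinc -> vinc -> vinc -> V) :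
  split_sum g (fun a b => split_sum a (fun c d => F c d b)) =
  split_sum g (fun a b => split_sum b (fun c d => F a c d)).
Proof.
pose F' (A B C : subgr (deg g)) := F (sub_vinc A) (sub_vinc B) (sub_vinc C).
transitivity (\sum_(P | dec (full g) P) \sum_(Q | dec P.1 Q) F' Q.1 Q.2 P.2).
  by apply: eq_bigr => P /and3P[l1 _ _]; rewrite (@split_sum_sub _ _ _ _ l1).
rewrite (sum_dec_assoc (full g) F'); apply: eq_bigr => P /and3P[_ l2 _].
by rewrite (@split_sum_sub _ _ _ _ l2).
Qed.

Lemma split_sum_cat (V : nmodType) g h (G : vinc -> vinc -> V) :
  split_sum (vinc_cat g h) G =
  split_sum g (fun a b => split_sum h (fun c d =>
    G (vinc_cat a c) (vinc_cat b d))).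
Proof.
rewrite /split_sum pair_big /=.
pose prel (Y : subgr (deg g + deg h)) : subgr (deg g) :=
  (lshift (deg h) @^-1: Y.1, lshift (deg h) @^-1: Y.2).
pose prer (Y : subgr (deg g + deg h)) : subgr (deg h) :=
  (@rshift (deg g) (deg h) @^-1: Y.1, @rshift (deg g) (deg h) @^-1: Y.2).
have preK (Y : subgr (deg g + deg h)) : subgr_cat (prel Y) (prer Y) = Y.
  by case: Y => Y1 Y2; rewrite /subgr_cat /= !set_catK.
have catl (X : subgr (deg g)) (Y : subgr (deg h)) : prel (subgr_cat X Y) = X.
  by case: X => X1 X2; rewrite /prel /= !preim_set_catl.
have catr (X : subgr (deg g)) (Y : subgr (deg h)) : prer (subgr_cat X Y) = Y.
  by case: Y => Y1 Y2; rewrite /prer /= !preim_set_catr.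
have cat_inj (X : subgr (deg g)) (Y : subgr (deg h)) X' Y' :
    (subgr_cat X Y == subgr_cat X' Y') = (X == X') && (Y == Y').
  apply/eqP/andP => [e|[/eqP-> /eqP->]] //.
  by rewrite -(catl X Y) -{2}(catr X Y) e catl catr.
have catJ (X : subgr (deg g)) (Y : subgr (deg h)) X' Y' :
    join (subgr_cat X Y) (subgr_cat X' Y') =
    subgr_cat (join X X') (join Y Y').
  by rewrite /join /subgr_cat /= !set_catU.
rewrite (reindex_onto
  (fun P : (subgr (deg g) * subgr (deg g)) * (subgr (deg h) * subgr (deg h)) =>
    (subgr_cat P.1.1 P.2.1, subgr_cat P.1.2 P.2.2))
  (fun P => ((prel P.1, prel P.2), (prer P.1, prer P.2)))) /=; last first.
  by case=> A B /= _; rewrite !preK.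
symmetry; apply: eq_big => -[[A B] [C D]] /=.
  rewrite !catl !catr eqxx andbT /dec /= catJ full_cat cat_inj.
  (* The join equation keeps the edges of A and B inside g, off the junction, so legality splits
     over the two factors. *)
  case: (join A B =P full g) => [e|_]; last by rewrite /= !andbF.
  have [sA sB] : A.2 \subset vlinks g /\ B.2 \subset vlinks g.
    by have /(congr1 snd) /= <- := e; rewrite subsetUl subsetUr.
  rewrite !legal_subgr_cat // andbT -!andbA; congr andb.
  by rewrite andbCA.
case/andP=> h1 h2; have /dec_sub /= [_ sA _ sB] := h1.
case/and3P: h1 => lA lB _; case/and3P: h2 => lC lD _.
by rewrite !sub_vinc_cat.
Qed.

(** * The empty subgraph and the counit identities *)

Definition empty_subgr n : subgr n := (set0, set0).

Lemma legal_empty n : legalp (empty_subgr n).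
Proof. by apply/legalP => i; rewrite inE. Qed.

Lemma sub_vinc_eq_e g (X : subgr (deg g)) : legalp X ->
  (sub_vinc X == vinc_e) = (X == empty_subgr _).
Proof.
move=> lX; apply/eqP/eqP => [e|->]; last first.
  by apply: deg0_vinc_e; rewrite /deg /= cards0.
have X1 : X.1 = set0 by apply: cards0_eq; rewrite -[LHS]/(deg (sub_vinc X)) e.
case: X lX {e} X1 => V L /legalP /= lg V0; rewrite V0; congr pair.
by apply/setP => i; rewrite inE; apply/negP => /lg[]; rewrite V0 inE.
Qed.

Lemma join0 n (X : subgr n) : join (empty_subgr n) X = X.
Proof. by case: X => A B; rewrite /join /= !set0U. Qed.

Lemma joinC n (X Y : subgr n) : join X Y = join Y X.
Proof. by rewrite /join /= setUC [X.2 :|: _]setUC. Qed.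

(** An empty first component forces the second to be all of g, so a single decomposition
    survives. *)
Lemma split_sum_counitl (V : nmodType) g (G : vinc -> V) :
  split_sum g (fun a b => if a == vinc_e then G b else 0) = G g.
Proof.
rewrite /split_sum -big_mkcondr /= (big_pred1 (empty_subgr _, full g)) /=.
  by rewrite sub_vinc_full.
case=> A B /=; rewrite xpair_eqE; apply/andP/andP => [[/and3P[lA lB jn]]|].
  by rewrite sub_vinc_eq_e // => /eqP eA; rewrite eA join0 in jn *.
case=> /eqP -> /eqP ->; rewrite sub_vinc_eq_e ?legal_empty // /dec /=.
by rewrite legal_empty legal_full join0 !eqxx.
Qed.

Lemma split_sum_counitr (V : nmodType) g (G : vinc -> V) :
  split_sum g (fun a b => if b == vinc_e then G a else 0) = G g.
Proof.
rewrite -[RHS](split_sum_counitl g G) /split_sum.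
have swap_inj : injective (fun P : subgr (deg g) * subgr (deg g) => (P.2, P.1)).
  by case=> [a b] [c d] [-> ->].
rewrite (reindex_inj swap_inj) /=; apply: eq_bigl => -[A B].
by rewrite /dec /= joinC andbCA.
Qed.

Lemma split_sum_e (V : nmodType) (G : vinc -> vinc -> V) :
  split_sum vinc_e G = G vinc_e vinc_e.
Proof.
rewrite /split_sum (big_pred1 (empty_subgr _, empty_subgr _)) /=.
  by congr G; apply: deg0_vinc_e; rewrite /deg /= cards0.
have all0 (X : subgr (deg vinc_e)) : X = empty_subgr _.
  by case: X => A B; congr pair; apply/setP => -[].
case=> X Y; rewrite /dec /= (all0 X) (all0 Y) !legal_empty.
by rewrite (all0 (join _ _)) (all0 (full _)) !eqxx.
Qed.

(** * The heart coproduct as a sum over decompositions *)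

Lemma links_ip_of n (A L : {set 'I_n}) : links (val (ip_of A L)) = trim A L.
Proof. exact/links_ip_set/legal_trim. Qed.

(** Replaces the index type [IP A] by edge sets, whose type does not depend on A; vertex and edge
    sets can then be summed jointly as pairs. *)
Lemma sum_IP (V : nmodType) n (A : {set 'I_n}) (c : pred (IP A)) (F : IP A -> V) :
  \sum_(I : IP A | c I) F I =
  \sum_(L | legal A L && c (ip_of A L)) F (ip_of A L).
Proof.
rewrite (reindex_onto (ip_of A) (fun I => links (val I))) /=; last first.
  move=> I _; apply: val_inj; have lg := legal_links (valP I).
  by rewrite /= trim_legal // (ip_set_links (valP I)).
apply: eq_bigl => L; rewrite links_ip_of andbC; congr andb.
by apply/eqP/idP => [<-|]; [apply: legal_trim | apply: trim_legal].
Qed.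

Lemma comul_heart_basisE g :
  comul_heart_basis g = split_sum g (fun a b => << (a, b) >>).
Proof.
rewrite /split_sum /comul_heart_basis.
under eq_bigr => A _.
  under eq_bigr => A' _ do (rewrite sum_IP; under eq_bigr => L _ do rewrite sum_IP).
  (* Swapping A' with L brings each vertex set next to its own edge set. *)
  rewrite exchange_big /=.
  under eq_bigr => L _ do rewrite pair_big_dep /=.
  over.
rewrite pair_big_dep pair_big_dep /=.
apply: eq_big => -[[A L] [A' L']] /=.
  rewrite /dec /full /join /legalp /= andbT xpair_eqE.
  have [lA|] := boolP (legal A L); rewrite //= andbCA.
  have [lA'|] := boolP (legal A' L'); rewrite //= !trim_legal //.
  case: (A :|: A' =P _) => //= AA'.
  rewrite (glue_ip_set (is_ip_set lA) (is_ip_set lA')) !links_ip_set // AA'.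
  apply/eqP/eqP => [e|->]; last by rewrite (ip_set_links (is_ipT g)).
  by rewrite /vlinks -[val _]e links_ip_set // -AA'; apply: legalU.
by rewrite tens_basis.
Qed.

(** * A dual pair of bialgebras *)

HB.instance Definition _ (K : choiceType) (V : lmodType rat) (f : K -> V) :=
  GRing.isLinear.Build rat (freeQ K) V *:%R (lin_ext f) (lin_ext_linear f).

HB.instance Definition _ (K L : choiceType) (V : lmodType rat)
    (b : freeQ K -> freeQ L -> V) :=
  GRing.isLinear.Build rat (freeQ (K * L)%type) V *:%R (tlift b)
    (lin_ext_linear _).

(** * Linear and bilinear maps determined on the basis *)

Section Extension.
Variables K L : choiceType.

Lemma tliftU (V : lmodType rat) (b : freeQ K -> freeQ L -> V) k l :
  tlift b << (k, l) >> = b << k >> << l >>.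
Proof. exact: lin_extU. Qed.

Lemma linear_basis_ext (V : lmodType rat) (f g : freeQ K -> V) :
  linear f -> linear g -> (forall k, f << k >> = g << k >>) -> forall x, f x = g x.
Proof.
move=> lf lg fg x; rewrite -(lin_ext_id x) !linear_lin_ext //.
by apply: eq_lin_ext => k /=.
Qed.

End Extension.

Lemma lin_ext_sum (K : choiceType) (V : lmodType rat) (f : K -> V) (I : finType)
    (P : pred I) (F : I -> freeQ K) :
  lin_ext f (\sum_(i | P i) F i) = \sum_(i | P i) lin_ext f (F i).
Proof. exact: raddf_sum. Qed.

Lemma tlift_sum (K L : choiceType) (V : lmodType rat) (b : freeQ K -> freeQ L -> V)
    (I : finType) (P : pred I) (F : I -> freeQ (K * L)%type) :
  tlift b (\sum_(i | P i) F i) = \sum_(i | P i) tlift b (F i).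
Proof. exact: raddf_sum. Qed.

Section Bilinear.
Variables K L : choiceType.

Lemma bilinear_lin_ext (V : lmodType rat) (f : K -> L -> V) :
  bilinear_map (fun x y => lin_ext (fun a => lin_ext (f a) y) x).
Proof.
split=> [x|y]; last exact: lin_ext_linear.
move=> c y z; rewrite /lin_ext -/(lin_ext _ x) scaler_sumr -big_split /=.
apply: eq_bigr => k _; rewrite -!/(lin_ext _ _) linearP scalerDr !scalerA.
by rewrite mulrC.
Qed.

Lemma bilinear_basis_ext (V : lmodType rat) (f g : freeQ K -> freeQ L -> V) :
  bilinear_map f -> bilinear_map g ->
  (forall k l, f << k >> << l >> = g << k >> << l >>) ->
  forall x y, f x y = g x y.
Proof.
move=> [fr fl] [gr gl] fg x y; move: x; apply: linear_basis_ext => // k.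
by move: y; apply: linear_basis_ext.
Qed.

Lemma bilinear_sum (V : lmodType rat) (I : finType) (P : pred I)
    (b : I -> freeQ K -> freeQ L -> V) :
  (forall i, bilinear_map (b i)) ->
  bilinear_map (fun x y => \sum_(i | P i) b i x y).
Proof.
move=> h; split=> u c x y; rewrite scaler_sumr -big_split;
  by apply: eq_bigr => i _; have [h1 h2] := h i; rewrite ?h1 ?h2.
Qed.

Lemma bilinear_mcoeff k l :
  bilinear_map (fun (x : freeQ K) (y : freeQ L) => x@_k * y@_l : rat^o).
Proof.
split=> u c x y; rewrite mcoeffD mcoeffZ; first by rewrite mulrDr mulrCA.
by rewrite mulrDl -mulrA.
Qed.

Lemma bilinear_tens : bilinear_map (@tens K L).
Proof. exact: bilinear_lin_ext. Qed.

Lemma mcoeff_tens (x : freeQ K) (y : freeQ L) k l :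
  (tens x y)@_(k, l) = x@_k * y@_l.
Proof.
move: x y; apply: (bilinear_basis_ext (V := rat^o)).
- have [tr tl] := bilinear_tens.
  by split=> u c x y; rewrite ?tr ?tl mcoeffD mcoeffZ.
- exact: bilinear_mcoeff.
by move=> a b; rewrite tens_basis !mcoeffU xpair_eqE -mulnb natrM.
Qed.

Lemma tensUl k (y : freeQ L) : tens << k >> y = 
  lin_ext (fun l => << (k, l) >> : freeQ (K * L)%type) y.
Proof. exact: lin_extU. Qed.

Lemma tensUr (x : freeQ K) l : tens x << l >> = 
  lin_ext (fun k => << (k, l) >> : freeQ (K * L)%type) x.
Proof. by apply: eq_lin_ext => k; rewrite lin_extU. Qed.

End Bilinear.

Lemma bilinear_tens_mul (K : choiceType) (mul : freeQ K -> freeQ K -> freeQ K) :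
  bilinear_map (tens_mul mul).
Proof. exact: bilinear_lin_ext. Qed.

Section BasisProduct.
Variables (K : choiceType) (mul : freeQ K -> freeQ K -> freeQ K).
Variables (op : K -> K -> K) (e : K).
Hypotheses (mul_bilinear : bilinear_map mul)
  (mulU : forall a b, mul << a >> << b >> = << op a b >>).

Lemma basis_mulA : associative op -> associative mul.
Proof.
have [mr ml] := mul_bilinear.
move=> opA x y z; move: x; apply: linear_basis_ext => [c u v|c u v|a].
- by rewrite ml.
- by rewrite !ml.
move: y; apply: linear_basis_ext => [c u v|c u v|b].
- by rewrite ml mr.
- by rewrite mr ml.
move: z; apply: linear_basis_ext => [c u v|c u v|c]; rewrite ?mr //.
by rewrite !mulU opA.
Qed.

Lemma basis_mul1 : left_id e op -> left_id << e >> mul.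
Proof.
have [mr _] := mul_bilinear => op1.
by apply: linear_basis_ext => [c x y|c x y|a]; rewrite ?mr // mulU op1.
Qed.

Lemma basis_mulr1 : right_id e op -> right_id << e >> mul.
Proof.
have [_ ml] := mul_bilinear => op1.
by apply: linear_basis_ext => [c x y|c x y|a]; rewrite ?ml // mulU op1.
Qed.

End BasisProduct.

(** * A monoid on the basis with a compatible coproduct, and the dual structure *)

Section DualBialgebras.
Variables (K : choiceType) (op : K -> K -> K) (e : K).
Variables (I : K -> finType) (P : forall g, pred (I g)) (l r : forall g, I g -> K).

(* The pairs (l i, r i) with P i are the terms of the coproduct of g. *)
Definition splits (V : nmodType) g (G : K -> K -> V) : V :=
  \sum_(i : I g | P i) G (l i) (r i).

Hypotheses (opA : associative op) (op1 : left_id e op) (opr1 : right_id e op).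
(** Makes the counit multiplicative for [mul] and e group-like for [dcomul]. *)
Hypothesis op_eq_e : forall a b, (op a b == e) = (a == e) && (b == e).
Hypothesis splitsA : forall (V : nmodType) g (F : K -> K -> K -> V),
  splits g (fun a b => splits a (fun c d => F c d b)) =
  splits g (fun a b => splits b (fun c d => F a c d)).
Hypothesis splits_op : forall (V : nmodType) g h (G : K -> K -> V),
  splits (op g h) G =
  splits g (fun a b => splits h (fun c d => G (op a c) (op b d))).
Hypothesis splits_e : forall (V : nmodType) (G : K -> K -> V),
  splits e G = G e e.
Hypothesis splits_counitl : forall (V : nmodType) g (G : K -> V),
  splits g (fun a b => if a == e then G b else 0) = G g.
Hypothesis splits_counitr : forall (V : nmodType) g (G : K -> V),
  splits g (fun a b => if b == e then G a else 0) = G g.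

Variables (mul dmul : freeQ K -> freeQ K -> freeQ K).
Variables (comul dcomul : freeQ K -> freeQ (K * K)%type).
Hypotheses (mul_bilinear : bilinear_map mul) (dmul_bilinear : bilinear_map dmul).
Hypotheses (comul_linear : linear comul) (dcomul_linear : linear dcomul).
Hypothesis mulU : forall a b, mul << a >> << b >> = << op a b >>.
Hypothesis comulU : forall g,
  comul << g >> = splits g (fun a b => << (a, b) >>).
Hypothesis mcoeff_dmul : forall x y g,
  (dmul x y)@_g = splits g (fun a b => x@_a * y@_b).
Hypothesis mcoeff_dcomul : forall x a b, (dcomul x)@_(a, b) = x@_(op a b).

HB.instance Definition _ := GRing.isLinear.Build rat (freeQ K)
  (freeQ (K * K)%type) *:%R comul comul_linear.

HB.instance Definition _ := GRing.isLinear.Build rat (freeQ K)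
  (freeQ (K * K)%type) *:%R dcomul dcomul_linear.

Definition eta (c : rat) : freeQ K := c *: << e >>.

Definition eps (x : freeQ K) : rat := x@_e.

Lemma epsU a : eps << a >> = (a == e)%:R.
Proof. exact: mcoeffU. Qed.

Lemma eta1 : eta 1 = << e >>.
Proof. exact: scale1r. Qed.

Lemma eta_linear : linear (eta : rat^o -> freeQ K).
Proof. by move=> c x y; rewrite /eta scalerDl scalerA. Qed.

Lemma eps_scalar : scalar eps.
Proof. by move=> c x y; rewrite /eps mcoeffD mcoeffZ. Qed.

Lemma eps1 : eps (eta 1) = 1.
Proof. by rewrite eta1 epsU eqxx. Qed.

Lemma mul_is_algebra : is_algebra mul eta.
Proof.
split; rewrite ?eta1; first exact: mul_bilinear.
- exact: eta_linear.
- exact: basis_mulA opA.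
- exact: basis_mul1 op1.
- exact: basis_mulr1 opr1.
Qed.

Lemma comul_is_coalgebra : is_coalgebra comul eps.
Proof.
split.
- exact: comul_linear.
- exact: eps_scalar.
- apply: linear_basis_ext => [c x y|c x y|g]; try by rewrite !linearP.
  rewrite comulU !tlift_sum.
  transitivity (splits g (fun a b => splits a (fun c d =>
    << ((c, d), b) >> : freeQ (K * K * K)%type))).
    apply: eq_bigr => i _; rewrite tliftU comulU tensUr lin_ext_sum.
    by apply: eq_bigr => j _; rewrite /= lin_extU.
  rewrite splitsA.
  apply: eq_bigr => i _; rewrite tliftU comulU tensUl lin_ext_sum tlift_sum.
  by apply: eq_bigr => j _; rewrite /= lin_extU !tliftU !tens_basis.
- apply: linear_basis_ext => [c x y|c x y|g]; rewrite ?linearP //.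
  rewrite comulU tlift_sum -[RHS](splits_counitl g (fun a => << a >> : freeQ K)).
  apply: eq_bigr => i _; rewrite /= tliftU epsU.
  by case: eqP => _; rewrite ?scale1r ?scale0r.
- apply: linear_basis_ext => [c x y|c x y|g]; rewrite ?linearP //.
  rewrite comulU tlift_sum -[RHS](splits_counitr g (fun a => << a >> : freeQ K)).
  apply: eq_bigr => i _; rewrite /= tliftU epsU.
  by case: eqP => _; rewrite ?scale1r ?scale0r.
Qed.

Lemma mul_comul_bialgebra : is_bialgebra mul comul eta eps.
Proof.
have [mr ml] := mul_bilinear.
split; last exact: eps1.
- by split; [apply: mul_is_algebra | apply: comul_is_coalgebra].
- have [tr tl] := bilinear_tens_mul mul.
  apply: bilinear_basis_ext => [||g h].
  + by split=> u c x y; rewrite ?mr ?ml linearP.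
  + by split=> u c x y; rewrite linearP ?tr ?tl.
  rewrite mulU !comulU splits_op /tens_mul tlift_sum.
  apply: eq_bigr => i _; rewrite /= tliftU tlift_sum.
  by apply: eq_bigr => j _; rewrite /= tliftU !mulU tens_basis.
- by rewrite eta1 comulU splits_e tens_basis.
- apply: (bilinear_basis_ext (V := rat^o)) => [||a b].
  + by split=> u c x y; rewrite ?mr ?ml /eps mcoeffD mcoeffZ.
  + exact: bilinear_mcoeff.
  by rewrite mulU !epsU op_eq_e -mulnb natrM.
Qed.

(** Read on coefficients, associativity is [splitsA] with rational summands, and the unit laws are
    the two counit identities. *)
Lemma dmul_is_algebra : is_algebra dmul eta.
Proof.
split; rewrite ?eta1; first exact: dmul_bilinear.
- exact: eta_linear.
- move=> x y z; apply/malgP => g; rewrite !mcoeff_dmul.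
  transitivity (splits g (fun a b => splits b (fun c d => x@_a * y@_c * z@_d))).
    apply: eq_bigr => i _; rewrite mcoeff_dmul mulr_sumr.
    by apply: eq_bigr => j _; rewrite mulrA.
  rewrite -(splitsA g (fun a c d => x@_a * y@_c * z@_d)).
  by apply: eq_bigr => i _; rewrite mcoeff_dmul mulr_suml.
- move=> x; apply/malgP => g; rewrite mcoeff_dmul.
  rewrite -[RHS](splits_counitl g (fun a => x@_a)).
  apply: eq_bigr => i _; rewrite mcoeffU eq_sym.
  by case: eqP; rewrite ?mul1r ?mul0r.
- move=> x; apply/malgP => g; rewrite mcoeff_dmul.
  rewrite -[RHS](splits_counitr g (fun a => x@_a)).
  apply: eq_bigr => i _; rewrite mcoeffU eq_sym.
  by case: eqP; rewrite ?mulr1 ?mulr0.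
Qed.

Lemma dcomul_is_coalgebra : is_coalgebra dcomul eps.
Proof.
split.
- exact: dcomul_linear.
- exact: eps_scalar.
- move=> x; apply/malgP => -[[a b] c].
  (* Evaluating each stage at a basis triple reduces coassociativity to [opA] inside an index of
     x. *)
  have HL w : (tlift (fun a b => tens (dcomul a) b) w)@_((a, b), c) = w@_(op a b, c).
    move: w; apply: (linear_basis_ext (V := rat^o)) => [u y z|u y z|[k m]].
    + by rewrite linearP mcoeffD mcoeffZ.
    + by rewrite mcoeffD mcoeffZ.
    rewrite tliftU mcoeff_tens mcoeff_dcomul !mcoeffU xpair_eqE.
    by rewrite -mulnb natrM.
  have HR w : (tlift (fun a b => tens a (dcomul b)) w)@_(a, (b, c)) = w@_(a, op b c).
    move: w; apply: (linear_basis_ext (V := rat^o)) => [u y z|u y z|[k m]].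
    + by rewrite linearP mcoeffD mcoeffZ.
    + by rewrite mcoeffD mcoeffZ.
    rewrite tliftU mcoeff_tens mcoeff_dcomul !mcoeffU xpair_eqE.
    by rewrite -mulnb natrM.
  have HT w : (tlift (fun a w => tlift (fun b c => tens (tens a b) c) w) w)@_((a, b), c)
      = w@_(a, (b, c)) :> rat.
    move: w; apply: (linear_basis_ext (V := rat^o)) => [u y z|u y z|[k [m n]]].
    + by rewrite linearP mcoeffD mcoeffZ.
    + by rewrite mcoeffD mcoeffZ.
    by rewrite !tliftU !tens_basis !mcoeffU !xpair_eqE andbA.
  by rewrite HL HT HR !mcoeff_dcomul opA.
- move=> x; apply/malgP => g; rewrite -{2}(op1 g) -mcoeff_dcomul.
  move: (dcomul x); apply: (linear_basis_ext (V := rat^o)) => [u y z|u y z|[k m]].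
  + by rewrite linearP mcoeffD mcoeffZ.
  + by rewrite mcoeffD mcoeffZ.
  by rewrite tliftU mcoeffZ epsU !mcoeffU xpair_eqE -mulnb natrM.
- move=> x; apply/malgP => g; rewrite -{2}(opr1 g) -mcoeff_dcomul.
  move: (dcomul x); apply: (linear_basis_ext (V := rat^o)) => [u y z|u y z|[k m]].
  + by rewrite linearP mcoeffD mcoeffZ.
  + by rewrite mcoeffD mcoeffZ.
  by rewrite tliftU mcoeffZ epsU !mcoeffU xpair_eqE -mulnb natrM mulrC.
Qed.

Lemma mcoeff_tens_mul_dmul w z g h :
  (tens_mul dmul w z)@_(g, h) =
  splits g (fun a b => splits h (fun c d => w@_(a, c) * z@_(b, d))).
Proof.
move: w z; apply: (bilinear_basis_ext (V := rat^o)).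
- have [tr tl] := bilinear_tens_mul dmul.
  by split=> u c x y; rewrite ?tr ?tl mcoeffD mcoeffZ.
- apply: bilinear_sum => i; apply: bilinear_sum => j; exact: bilinear_mcoeff.
move=> [p q] [s t]; rewrite /tens_mul !tliftU mcoeff_tens !mcoeff_dmul.
rewrite mulr_suml; apply: eq_bigr => i _; rewrite mulr_sumr.
apply: eq_bigr => j _; rewrite !mcoeffU !xpair_eqE -!mulnb !natrM.
by rewrite mulrACA.
Qed.

(** For compatibility, the coefficient of [dcomul (dmul x y)] at (g, h) is that of [dmul x y] at
    [op g h], which [splits_op] expands into the double sum of the tensor product. *)
Lemma dmul_dcomul_bialgebra : is_bialgebra dmul dcomul eta eps.
Proof.
split; last exact: eps1.
- by split; [apply: dmul_is_algebra | apply: dcomul_is_coalgebra].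
- move=> x y; apply/malgP => -[g h].
  rewrite mcoeff_dcomul mcoeff_dmul splits_op mcoeff_tens_mul_dmul.
  by apply: eq_bigr => i _; apply: eq_bigr => j _; rewrite !mcoeff_dcomul.
- apply/malgP => -[a b]; rewrite eta1 mcoeff_dcomul mcoeff_tens !mcoeffU.
  by rewrite ![e == _]eq_sym op_eq_e -mulnb natrM.
- by move=> x y; rewrite /eps mcoeff_dmul splits_e.
Qed.

End DualBialgebras.

(** * Antipodes and filtrations *)

Lemma eq_in_lin_ext (K : choiceType) (V : lmodType rat) (f g : K -> V) x :
  {in msupp x, f =1 g} -> lin_ext f x = lin_ext g x.
Proof. by move=> fg; apply: eq_big_seq => k kx; rewrite fg. Qed.

Lemma linear_for0 (U V : lmodType rat) (f : U -> V) : linear f -> f 0 = 0.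
Proof. by move=> lf; have := lf (-1) 0 0; rewrite !scaleN1r !addNr. Qed.

Section Antipode.
Variables (K : choiceType).
Local Notation H := (freeQ K).
Local Notation HH := (freeQ (K * K)%type).
Variables (mul : H -> H -> H) (comul : H -> HH) (eta : rat -> H) (eps : H -> rat).
Variables (e : K) (deg : K -> nat).
Hypothesis bialg : is_bialgebra mul comul eta eps.
Hypothesis eta1 : eta 1 = << e >>.
Hypothesis deg_comul : forall g kl, kl \in msupp (comul << g >>) ->
  (deg kl.1 + deg kl.2)%N = deg g.
Hypothesis deg0 : forall k, deg k = 0%N -> k = e.

Definition conv (f g : H -> H) (x : H) : H :=
  tlift (fun a b => mul (f a) (g b)) (comul x).

Definition aug (x : H) : H := x - eta (eps x).

Fixpoint aug_pow n : H -> H :=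
  if n is m.+1 then conv aug (aug_pow m) else fun x => eta (eps x).

Let alg : is_algebra mul eta. Proof. by case: bialg => -[]. Qed.
Let coalg : is_coalgebra comul eps. Proof. by case: bialg => -[]. Qed.
Let mulr_lin x : linear (mul x). Proof. by case: alg => -[]. Qed.
Let mull_lin y : linear (mul^~ y). Proof. by case: alg => -[]. Qed.
Let comul_lin : linear comul. Proof. by case: coalg. Qed.
Let eps_lin : scalar eps. Proof. by case: coalg. Qed.
Let mul_assoc : associative mul. Proof. by case: alg. Qed.
Let mul_unitl : left_id << e >> mul. Proof. by rewrite -eta1; case: alg. Qed.
Let mul_unitr : right_id << e >> mul. Proof. by rewrite -eta1; case: alg. Qed.

Let mulZr x c y : mul x (c *: y) = c *: mul x y.
Proof. by have := mulr_lin x c y 0; rewrite (linear_for0 (mulr_lin x)) !addr0. Qed.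

Let mulZl x c y : mul (c *: x) y = c *: mul x y.
Proof. by have := mull_lin y c x 0; rewrite (linear_for0 (mull_lin y)) !addr0. Qed.

Let etaE c : eta c = c *: << e >>.
Proof.
have [_ lin _ _ _] := alg; have := lin c 1 0.
rewrite (linear_for0 (f := eta : rat^o -> H) lin) !addr0 -eta1 => <-.
by rewrite [c *: _]mulr1.
Qed.

Lemma conv_linear f g : linear (conv f g).
Proof. by move=> c x y; rewrite /conv comul_lin linearP. Qed.

Lemma eta_eps_linear : linear (fun x => eta (eps x)).
Proof. by move=> c x y; rewrite !etaE eps_lin scalerDl scalerA. Qed.

Lemma aug_linear : linear aug.
Proof.
move=> c x y; rewrite /aug eta_eps_linear scalerBr opprD addrACA.
by rewrite -!addrA.
Qed.

Lemma aug_pow_linear n : linear (aug_pow n).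
Proof. by case: n => [|n]; [apply: eta_eps_linear | apply: conv_linear]. Qed.

Lemma convA f g h : linear f -> linear g -> linear h ->
  forall x, conv (conv f g) h x = conv f (conv g h) x.
Proof.
move=> lf lg lh x.
(* T applies f, g, h to the three tensor factors and multiplies; the two bracketings are T of the
   two sides of coassociativity. *)
pose T : freeQ (K * K * K)%type -> H := lin_ext (fun abc =>
  mul (mul (f << abc.1.1 >>) (g << abc.1.2 >>)) (h << abc.2 >>)).
have lT : linear T by apply: lin_ext_linear.
have TL w : T (tlift (fun a b => tens (comul a) b) w) =
    tlift (fun a b => mul (conv f g a) (h b)) w.
  move: w; apply: linear_basis_ext => [c u v|c u v|[k l]].
  - by rewrite linearP lT.
  - by rewrite linearP.
  rewrite !tliftU tensUr /conv; move: (comul << k >>).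
  apply: linear_basis_ext => [c u v|c u v|[a b]].
  - by rewrite linearP lT.
  - by rewrite linearP mull_lin.
  by rewrite lin_extU tliftU /T lin_extU.
pose C a w := tlift (fun b c => tens (tens a b) c) w : freeQ (K * K * K)%type.
have TR w : T (tlift C (tlift (fun a b => tens a (comul b)) w)) =
    tlift (fun a b => mul (f a) (conv g h b)) w.
  move: w; apply: linear_basis_ext => [c u v|c u v|[k l]].
  - by rewrite !linearP lT.
  - by rewrite linearP.
  rewrite !tliftU tensUl /conv; move: (comul << l >>).
  apply: linear_basis_ext => [c u v|c u v|[a b]].
  - by rewrite !linearP lT.
  - by rewrite linearP mulr_lin.
  by rewrite lin_extU !tliftU /C tliftU !tens_basis /T lin_extU mul_assoc.
by rewrite /conv -/(conv f g) -/(conv g h) -TL -TR; case: coalg => _ _ -> _ _.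
Qed.

Lemma conv_unitr f : linear f -> forall x, conv f (fun y => eta (eps y)) x = f x.
Proof.
move=> lf x; have [_ _ _ _ cu] := coalg; rewrite -{2}(cu x) /conv.
move: (comul x); apply: linear_basis_ext => [c u v|c u v|[k l]].
- by rewrite linearP.
- by rewrite linearP lf.
rewrite !tliftU etaE mulZr mul_unitr.
by have := lf (eps << l >>) << k >> 0; rewrite (linear_for0 lf) !addr0.
Qed.

Lemma conv_unitl f : linear f -> forall x, conv (fun y => eta (eps y)) f x = f x.
Proof.
move=> lf x; have [_ _ _ cu _] := coalg; rewrite -{2}(cu x) /conv.
move: (comul x); apply: linear_basis_ext => [c u v|c u v|[k l]].
- by rewrite linearP.
- by rewrite linearP lf.
rewrite !tliftU etaE mulZl mul_unitl.
by have := lf (eps << k >>) << l >> 0; rewrite (linear_for0 lf) !addr0.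
Qed.

Lemma eq_conv f f' g g' : f =1 f' -> g =1 g' -> conv f g =1 conv f' g'.
Proof. by move=> ef eg x; apply: eq_lin_ext => kl; rewrite ef eg. Qed.

(** The recursion adds factors on the left; multiplying a power by the identity on the right needs
    them added there too. *)
Lemma aug_powSr n x : aug_pow n.+1 x = conv (aug_pow n) aug x.
Proof.
elim: n x => [|n IH] x.
  by rewrite (conv_unitl aug_linear); apply: (conv_unitr aug_linear).
rewrite -[aug_pow n.+2]/(conv aug (aug_pow n.+1)).
rewrite (convA aug_linear (aug_pow_linear n) aug_linear).
exact: eq_conv.
Qed.

(** The identity is the convolution unit plus [aug]; two consecutive powers appear, so an
    alternating sum telescopes. *)
Lemma aug_pow_conv_id n x : conv (aug_pow n) id x = aug_pow n x + aug_pow n.+1 x.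
Proof.
rewrite aug_powSr -(conv_unitr (aug_pow_linear n) x) /conv.
move: (comul x); apply: linear_basis_ext => [c u v|c u v|[k l]].
- by rewrite linearP.
- by rewrite !linearP scalerDr addrACA.
have mulD y z t : mul y (z + t) = mul y z + mul y t.
  by have := mulr_lin y 1 z t; rewrite !scale1r.
by rewrite !tliftU -mulD /aug addrC subrK.
Qed.

Lemma id_conv_aug_pow n x : conv id (aug_pow n) x = aug_pow n x + aug_pow n.+1 x.
Proof.
rewrite -[aug_pow n.+1 x]/(conv aug (aug_pow n) x).
rewrite -(conv_unitl (aug_pow_linear n) x) /conv.
move: (comul x); apply: linear_basis_ext => [c u v|c u v|[k l]].
- by rewrite linearP.
- by rewrite !linearP scalerDr addrACA.
have mulD y z t : mul (y + z) t = mul y t + mul z t.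
  by have := mull_lin t 1 y z; rewrite !scale1r.
by rewrite !tliftU -mulD /aug addrC subrK.
Qed.

Lemma aug_e : aug << e >> = 0.
Proof.
by case: bialg => _ _ _ _; rewrite /aug -eta1 => ->; rewrite subrr.
Qed.

(** Each factor [aug] kills e, the only basis element of degree 0, so it uses up at least one unit
    of the degree. *)
Lemma aug_pow_eq0 n g : (deg g < n)%N -> aug_pow n << g >> = 0.
Proof.
elim: n g => [//|n IH] g lt.
rewrite -[LHS]/(conv aug (aug_pow n) << g >>) /conv /tlift /lin_ext.
apply: big1_seq => -[k l] /andP[_ kl] /=; have := deg_comul kl => /= dg.
have [k0|kn] := posnP (deg k).
  by rewrite (deg0 k0) aug_e (linear_for0 (mull_lin _)) scaler0.
by rewrite IH ?(linear_for0 (mulr_lin _)) ?scaler0 //; lia.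
Qed.

(* The inverse of id = eta eps + aug for convolution; the powers of aug beyond
   the degree of g vanish on g. *)
Definition neumann_antipode : H -> H :=
  lin_ext (fun g => \sum_(j < (deg g).+1) (-1) ^+ j *: aug_pow j << g >>).

(** Allows all terms of a coproduct to share one truncation bound. *)
Lemma neumann_antipodeE N g : (deg g <= N)%N ->
  neumann_antipode << g >> = \sum_(j < N.+1) (-1) ^+ j *: aug_pow j << g >>.
Proof.
move=> le; rewrite /neumann_antipode lin_extU.
rewrite (big_ord_widen N.+1 (fun j => (-1) ^+ j *: aug_pow j << g >>)) //.
rewrite big_mkcond; apply: eq_bigr => j _; case: ltnP => // lt.
by rewrite aug_pow_eq0 // scaler0.
Qed.

Lemma telescope_alternating (V : lmodType rat) (a : nat -> V) M :
  \sum_(j < M) (-1) ^+ j *: (a j + a j.+1) = a 0%N - (-1) ^+ M *: a M.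
Proof.
elim: M => [|M IH]; first by rewrite big_ord0 expr0 scale1r subrr.
rewrite big_ord_recr /= IH exprS mulN1r scaleNr opprK scalerDr.
by rewrite addrA subrK.
Qed.

Lemma neumann_antipodeP : is_antipode mul comul eta eps neumann_antipode.
Proof.
have mul_suml (I : finType) (F : I -> H) y : mul (\sum_i F i) y = \sum_i mul (F i) y.
  pose f : {linear H -> H} := HB.pack (mul^~ y)
    (GRing.isLinear.Build _ _ _ _ _ (mull_lin y)).
  exact: (raddf_sum f).
have mul_sumr (I : finType) (F : I -> H) y : mul y (\sum_i F i) = \sum_i mul y (F i).
  pose f : {linear H -> H} := HB.pack (mul y)
    (GRing.isLinear.Build _ _ _ _ _ (mulr_lin y)).
  exact: (raddf_sum f).
have sum_tlift N (b : nat -> H -> H -> H) w :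
    \sum_(j < N) (-1) ^+ j *: tlift (b j) w =
    tlift (fun x y => \sum_(j < N) (-1) ^+ j *: b j x y) w.
  move: w; apply: linear_basis_ext => [c u v|c u v|[k l]].
  - rewrite scaler_sumr -big_split; apply: eq_bigr => j _ /=.
    by rewrite linearP scalerDr !scalerA mulrC.
  - by rewrite linearP.
  by rewrite tliftU; apply: eq_bigr => j _; rewrite tliftU.
split; first exact: lin_ext_linear.
- apply: linear_basis_ext => [c u v|c u v|g].
  - exact: (conv_linear neumann_antipode id).
  - exact: eta_eps_linear.
  (* Every factor in the coproduct of g has degree at most [deg g], so one truncation serves them
     all. After telescoping the remainder is the power [(deg g).+1], which vanishes on g. *)
  transitivity (\sum_(j < (deg g).+1) (-1) ^+ j *: conv (aug_pow j) id << g >>).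
    rewrite (sum_tlift _ (fun j a b => mul (aug_pow j a) b)).
    apply: eq_in_lin_ext => -[k l] /deg_comul /= dg.
    rewrite (@neumann_antipodeE (deg g)); last by lia.
    by rewrite mul_suml; apply: eq_bigr => j _; rewrite mulZl.
  under eq_bigr => j _ do rewrite aug_pow_conv_id.
  rewrite (telescope_alternating (fun j => aug_pow j << g >>)).
  by rewrite (@aug_pow_eq0 (deg g).+1) // scaler0 subr0.
- apply: linear_basis_ext => [c u v|c u v|g].
  - exact: (conv_linear id neumann_antipode).
  - exact: eta_eps_linear.
  transitivity (\sum_(j < (deg g).+1) (-1) ^+ j *: conv id (aug_pow j) << g >>).
    rewrite (sum_tlift _ (fun j a b => mul a (aug_pow j b))).
    apply: eq_in_lin_ext => -[k l] /deg_comul /= dg.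
    rewrite (@neumann_antipodeE (deg g)); last by lia.
    by rewrite mul_sumr; apply: eq_bigr => j _; rewrite mulZr.
  under eq_bigr => j _ do rewrite id_conv_aug_pow.
  rewrite (telescope_alternating (fun j => aug_pow j << g >>)).
  by rewrite (@aug_pow_eq0 (deg g).+1) // scaler0 subr0.
Qed.

End Antipode.

(** * The filtration by degree, read on supports *)

Section Filtration.
Variables (K : choiceType) (deg : K -> nat).
Local Notation H := (freeQ K).

Definition homog n (x : H) : Prop := forall k, k \in msupp x -> deg k = n.

Local Notation F := (filtration_of_grading homog).

Lemma filtrationP n x : F n x <-> forall k, k \in msupp x -> (deg k <= n)%N.
Proof.
split=> [[y hy ->] k|h].
  rewrite -mcoeff_neq0 raddf_sum => ne.
  have [j nj] : exists j : 'I_n.+1, (y j)@_k != 0.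
    apply/existsP; apply: contraNT ne; rewrite negb_exists => /forallP y0.
    by rewrite big1 // => j _; apply/eqP/negPn/y0.
  by rewrite (hy j k) -?mcoeff_neq0 // -ltnS.
(* The component of degree j is extracted by sending all other basis elements to 0. *)
have cE (j : nat) k : (lin_ext (fun k => if deg k == j then << k >> else 0 : H) x)@_k =
    if deg k == j then x@_k else 0.
  move: x {h}; apply: (linear_basis_ext (V := rat^o)) => [c u v|c u v|g].
  - by rewrite linearP mcoeffD mcoeffZ.
  - by rewrite mcoeffD mcoeffZ; case: eqP => // _; rewrite scaler0 addr0.
  rewrite lin_extU mcoeffU; have [->|ne] := eqVneq g k.
    by case: eqP => _; rewrite ?mcoeffUU ?mcoeff0.
  by rewrite (fun_if (mcoeff k)) mcoeffU mcoeff0 (negbTE ne) !if_same.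
exists (fun j : 'I_n.+1 => lin_ext (fun k => if deg k == j then << k >> else 0) x).
  move=> j k; rewrite -mcoeff_neq0 cE.
  by case: (deg k =P j) => // _; rewrite eqxx.
apply/malgP => k; rewrite raddf_sum.
case: (boolP (k \in msupp x)) => kx.
  rewrite (bigD1 (Ordinal (h k kx : deg k < n.+1)%N)) //= cE eqxx.
  rewrite big1 ?addr0 // => j jn; rewrite cE; case: eqP => // e; case/negP: jn.
  by apply/eqP; apply: val_inj; rewrite /= e.
rewrite (mcoeff_outdom kx) big1 // => j _; rewrite /= cE.
by rewrite (mcoeff_outdom kx) if_same.
Qed.

Lemma filtration_connected e :
  (forall k, deg k = 0%N <-> k = e) -> is_connected F.
Proof.
move=> deg0; exists << e >>.
  split; last by rewrite monalgU_eq0 oner_eq0.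
  apply/filtrationP => k /(fsubsetP msuppU_le); rewrite in_fset1 => /eqP->.
  by rewrite (deg0 e).2.
move=> x; split=> [/filtrationP h|[c ->]].
  exists x@_e; apply/malgP => k; rewrite mcoeffZ mcoeffU.
  have [->|ne] := eqVneq e k; first by rewrite mulr1.
  rewrite mulr0; apply/mcoeff_outdom/negP => /h; rewrite leqn0 => /eqP/deg0 ke.
  by rewrite ke eqxx in ne.
apply/filtrationP => k /(fsubsetP (msuppZ_le _ _))/(fsubsetP msuppU_le).
by rewrite in_fset1 => /eqP->; rewrite (deg0 e).2.
Qed.

Lemma tensor_filtration_supp n (w : freeQ (K * K)%type) :
  (forall kl, kl \in msupp w -> (deg kl.1 + deg kl.2 <= n)%N) ->
  tensor_filtration F n w.
Proof.
move=> h; exists [seq (w@_kl *: << kl.1 >>, << kl.2 >>) | kl <- msupp w].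
  rewrite big_map -[LHS]lin_ext_id; apply: eq_bigr => -[k l] _ /=.
  have [_ tl] := bilinear_tens K K.
  have := tl << l >> (w@_(k, l)) << k >> 0.
  by rewrite (linear_for0 (tl _)) !addr0 tens_basis.
move=> _ /mapP[[k l] kl ->]; have /= le := h _ kl.
(* The second index is n - [deg k] rather than [deg l], since the indices must add up to n exactly;
   the filtration absorbs the slack. *)
exists (deg k), (n - deg k)%N; split; first lia.
- apply/filtrationP => i /(fsubsetP (msuppZ_le _ _))/(fsubsetP msuppU_le).
  by rewrite in_fset1 => /eqP->.
apply/filtrationP => i /(fsubsetP msuppU_le).
by rewrite in_fset1 => /eqP->; lia.
Qed.

End Filtration.

(** * The bialgebras of vincular patterns *)

Lemma bilinear_black : bilinear_map black.
Proof. exact: bilinear_lin_ext. Qed.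

Lemma bilinear_heart : bilinear_map heart.
Proof. exact: bilinear_lin_ext. Qed.

Lemma linear_comul_black : linear comul_black.
Proof. exact: lin_ext_linear. Qed.

Lemma linear_comul_heart : linear comul_heart.
Proof. exact: lin_ext_linear. Qed.

Lemma blackU a b : black << a >> << b >> = << vinc_cat a b >>.
Proof. by rewrite /black !lin_extU. Qed.

Lemma comul_heartU g :
  comul_heart << g >> = split_sum g (fun a b => << (a, b) >>).
Proof. by rewrite /comul_heart lin_extU comul_heart_basisE. Qed.

Lemma mcoeff_comul_black x a b : (comul_black x)@_(a, b) = x@_(vinc_cat a b).
Proof.
move: x; apply: (linear_basis_ext (V := rat^o)) => [c x y|c x y|g].
- by rewrite linear_comul_black mcoeffD mcoeffZ.
- by rewrite mcoeffD mcoeffZ.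
have := pairing_comul_black a b g.
by rewrite tens_basis blackU !pairing_basis.
Qed.

Lemma mcoeff_heartE x y g :
  (heart x y)@_g = split_sum g (fun a b => x@_a * y@_b).
Proof.
move: x y; apply: (bilinear_basis_ext (V := rat^o)).
- have [hr hl] := bilinear_heart.
  by split=> u c x y; rewrite ?hr ?hl mcoeffD mcoeffZ.
- by apply: bilinear_sum => P; apply: bilinear_mcoeff.
move=> a b; rewrite mcoeff_heart tens_basis pairing_basis comul_heartU.
rewrite raddf_sum; apply: eq_bigr => P _ /=.
by rewrite !mcoeffU xpair_eqE -mulnb natrM ![_ == sub_vinc _]eq_sym.
Qed.

Lemma vinc_cat_eq_e a b :
  (vinc_cat a b == vinc_e) = (a == vinc_e) && (b == vinc_e).
Proof.
apply/eqP/andP => [h|[/eqP-> /eqP->]]; last by rewrite vinc_0cat.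
have : (deg a + deg b = 0)%N by rewrite -[LHS]/(deg (vinc_cat a b)) h.
by move/eqP; rewrite addn_eq0 => /andP[/eqP/deg0_vinc_e-> /eqP/deg0_vinc_e->].
Qed.

Lemma black_comul_heart_bialgebra :
  is_bialgebra black comul_heart unit_vinc counit_vinc.
Proof.
exact: (mul_comul_bialgebra vinc_catA vinc_0cat vinc_cat0 vinc_cat_eq_e
  split_sum_assoc split_sum_cat split_sum_e split_sum_counitl split_sum_counitr
  bilinear_black linear_comul_heart blackU comul_heartU).
Qed.

Lemma heart_comul_black_bialgebra :
  is_bialgebra heart comul_black unit_vinc counit_vinc.
Proof.
exact: (dmul_dcomul_bialgebra vinc_catA vinc_0cat vinc_cat0 vinc_cat_eq_e
  split_sum_assoc split_sum_cat split_sum_e split_sum_counitl split_sum_counitr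
  bilinear_heart linear_comul_black mcoeff_heartE mcoeff_comul_black).
Qed.

Lemma deg_eq0 k : deg k = 0%N <-> k = vinc_e.
Proof. by split=> [/deg0_vinc_e|->]. Qed.

Lemma heart_hopf_algebra :
  is_hopf_algebra heart comul_black unit_vinc counit_vinc.
Proof.
split; first exact: heart_comul_black_bialgebra.
exists (neumann_antipode heart comul_black unit_vinc counit_vinc deg).
apply: (neumann_antipodeP heart_comul_black_bialgebra (e := vinc_e)).
- exact: scale1r.
- move=> g [a b]; rewrite -mcoeff_neq0 mcoeff_comul_black mcoeffU /=.
  by case: (g =P vinc_cat a b) => [-> //|_]; rewrite eqxx.
- exact: deg0_vinc_e.
Qed.

Lemma heart_filtered :
  is_filtered heart comul_black (filtration_of_grading homogeneous).
Proof.
split=> [p q x y /filtrationP hx /filtrationP hy|n x /filtrationP hx].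
  apply/filtrationP => g; rewrite -mcoeff_neq0 mcoeff_heartE => ne.
  have [P dP nP] : exists2 P, dec (full g) P &
      x@_(sub_vinc P.1) * y@_(sub_vinc P.2) != 0.
    apply/exists_inP; apply: contraNT ne; rewrite negb_exists_in => /forall_inP h.
    by apply/eqP/big1 => P /h/negPn/eqP.
  move: nP; rewrite mulf_eq0 negb_or !mcoeff_neq0 => /andP[/hx hp /hy hq].
  apply: leq_trans (leq_add hp hq); case/and3P: dP => _ _ /eqP/(congr1 fst) /= jn.
  (* The two vertex sets cover [n] but may overlap, so only an inequality between degrees
     results. *)
  rewrite -[X in (X <= _)%N]card_ord -cardsT -jn cardsU; exact: leq_subr.
apply: tensor_filtration_supp => -[a b].
by rewrite -mcoeff_neq0 mcoeff_comul_black mcoeff_neq0 => /hx.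
Qed.

Theorem theorem4p13 :
  is_bialgebra black comul_heart unit_vinc counit_vinc /\
  (is_hopf_algebra heart comul_black unit_vinc counit_vinc /\
   is_filtered heart comul_black (filtration_of_grading homogeneous) /\
   is_connected (filtration_of_grading homogeneous)).
Proof.
split; first exact: black_comul_heart_bialgebra.
split; first exact: heart_hopf_algebra.
split; first exact: heart_filtered.
exact: (filtration_connected deg_eq0).
Qed.
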